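(* Let $\delta>0$ and $V:\mathbb{Z}\to\mathbb{R}$ be such that $\Delta^{\!\delta} V$ is everywhere positive and bounded, and $$\Lambda:=\sup_{\kappa\in\mathbb{Z}}\frac{\big(\Delta^{\!\delta}[(\Delta^{\!\delta} V)^2]\big)_\kappa}{(\Delta^{\!\delta} V)_\kappa}<\infty.$$ Then the semigroup $\mathfrak{S}$ on $\mathcal{P}^\delta_{2,c}$ generated by the system $\dot\rho_\kappa=\big(\Delta^{\!\delta}(\rho\,\Delta^{\!\delta} V)\big)_\kappa$, $\kappa\in\mathbb{Z}$, is $(-\Lambda)$-contractive with respect to the energy $\mathcal{E}(\rho)=-\delta\sum_\kappa V_\kappa\rho_\kappa$.
   Context: Fix $\delta>0$. For $f:\mathbb{Z}\to\mathbb{R}$, $(\Delta^{\!\delta} f)_\kappa=(f_{\kappa+1}+f_{\kappa-1}-2f_\kappa)/\delta^2$; products and squares of grid functions are pointwise. $\mathcal{P}^\delta_{2,c}$ is the set of $\rho:\mathbb{Z}\to[0,\infty)$ with $\delta\sum_\kappa\rho_\kappa=1$, $\delta\sum_\kappa(\delta\kappa)^2\rho_\kappa<\infty$, $\delta\sum_\kappa(\delta\kappa)\rho_\kappa=0$. Define $Q(p,r)=p^2/r$ if $r>0$, $Q(0,0)=0$, $Q(p,0)=+\infty$ if $p\ne0$. $\mathcal{C}(\rho^0,\rho^1)$ is the set of pairs $(\rho,\mathfrak{w})$, $\rho:[0,1]\to\mathcal{P}^\delta_{2,c}$, $\mathfrak{w}:[0,1]\to\ell^2$, with $\rho(0)=\rho^0$,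 $\rho(1)=\rho^1$, $\rho_\kappa\in H^1(0,1)$, $\mathfrak{w}_\kappa\in L^2(0,1)$ and $\dot\rho_\kappa=(\Delta^{\!\delta}\mathfrak{w})_\kappa$ a.e., for each $\kappa$. The distance is ${\mathbb{D}}^\delta(\rho^0,\rho^1)^2=\inf_{\mathcal{C}(\rho^0,\rho^1)}\delta\sum_\kappa\int_0^1Q(\mathfrak{w}_\kappa(s),\rho_\kappa(s))\,ds$. A semigroup $\mathfrak{S}$ on $\mathcal{P}^\delta_{2,c}$ is $\lambda$-contractive with respect to $\mathcal{E}$ if for all $\bar\rho,\bar\eta\in\mathcal{P}^\delta_{2,c}$ with ${\mathbb{D}}^\delta(\bar\rho,\bar\eta)<\infty$ the evolution variational inequality $$\limsup_{t\downarrow0}\frac{{\mathbb{D}}^\delta(\mathfrak{S}^t\bar\rho,\bar\eta)^2-{\mathbb{D}}^\delta(\bar\rho,\bar\eta)^2}{2t}+\frac\lambda2{\mathbb{D}}^\delta(\bar\rho,\bar\eta)^2\le\mathcal{E}(\bar\eta)-\mathcal{E}(\bar\rho)$$ holds. *)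

(* Defs.v *)
From HB Require Import structures.
From mathcomp Require Import all_boot all_order all_algebra.
From mathcomp Require Import all_classical all_reals all_analysis.
Set Implicit Arguments. Unset Strict Implicit. Unset Printing Implicit Defensive.
Import Order.TTheory GRing.Theory Num.Theory.
Import numFieldNormedType.Exports.
Local Open Scope classical_set_scope.
Local Open Scope ring_scope.

Section Defs.
Variable R : realType.

Definition I01 : set R := `[0%R, 1%R]%classic.

Definition dlap (delta : R) (f : int -> R) : int -> R :=
  fun k => (f (k + 1)%R + f (k - 1)%R - 2 * f k) / delta ^+ 2.

Definition zsum (f : int -> R) : \bar R :=
  (\esum_(k in [set: int]) (Num.max (f k) 0)%R%:E -
   \esum_(k in [set: int]) (Num.max (- f k) 0)%R%:E)%E.

Definition P2c (delta : R) (rho : int -> R) : Prop :=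
  (forall k, 0 <= rho k) /\
  zsum (fun k => delta * rho k) = 1%:E /\
  (zsum (fun k => (delta * (delta * k%:~R) ^+ 2 * rho k)%R) < +oo)%E /\
  zsum (fun k => delta * (delta * k%:~R) * rho k) = 0%:E.

Definition Qf (p r : R) : \bar R :=
  if 0 < r then (p ^+ 2 / r)%R%:E else if p == 0 then 0%E else +oo%E.

Definition ell2 (w : int -> R) : Prop :=
  (\esum_(k in [set: int]) ((w k) ^+ 2)%R%:E < +oo)%E.

Definition L2_01 (g : R -> R) : Prop :=
  measurable_fun I01 g /\
  (\int[lebesgue_measure]_(s in I01) ((g s) ^+ 2)%R%:E < +oo)%E.

(* f in H^1(0,1) with weak derivative g (1-d: f absolutely continuous,
   f(t) = f(0) + int_0^t g, with g in L^2(0,1)) *)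
Definition H1_01_deriv (f g : R -> R) : Prop :=
  L2_01 g /\
  forall t, 0 <= t <= 1 ->
    f t = f 0 + \int[lebesgue_measure]_(s in (`[0%R, t]%classic : set R)) g s.

Definition admissible (delta : R) (rho0 rho1 : int -> R)
    (rho w : R -> int -> R) : Prop :=
  (forall s, 0 <= s <= 1 -> P2c delta (rho s)) /\
  (forall s, 0 <= s <= 1 -> ell2 (w s)) /\
  rho 0 = rho0 /\ rho 1 = rho1 /\
  forall k : int,
    L2_01 (fun s => w s k) /\
    exists g : R -> R,
      H1_01_deriv (fun s => rho s k) g /\
      {ae lebesgue_measure, forall s, I01 s ->
         g s = dlap delta (w s) k}.

Definition action (delta : R) (rho w : R -> int -> R) : \bar R :=
  (delta%:E * \esum_(k in [set: int])
     \int[lebesgue_measure]_(s in I01) Qf (w s k) (rho s k))%E.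

Definition Dsq (delta : R) (rho0 rho1 : int -> R) : \bar R :=
  ereal_inf [set a | exists rho w, admissible delta rho0 rho1 rho w /\
                                   a = action delta rho w].

Definition energy (delta : R) (V rho : int -> R) : \bar R :=
  (- zsum (fun k => (delta * V k * rho k)%R))%E.

Definition generated_semigroup (delta : R) (V : int -> R)
    (S : R -> (int -> R) -> (int -> R)) : Prop :=
  forall rb, P2c delta rb ->
    S 0 rb = rb /\
    (forall t, 0 <= t -> P2c delta (S t rb)) /\
    (forall t s, 0 <= t -> 0 <= s -> S (t + s) rb = S t (S s rb)) /\
    forall k : int,
      ((fun t : R => S t rb k) @ (0:R)^'+ --> rb k) /\
      forall t : R, 0 < t ->
        is_derive t (1:R) (fun u : R => S u rb k)
          (dlap delta (fun j => S t rb j * dlap delta V j) k).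

Definition lambda_contractive (delta lambda : R)
    (S : R -> (int -> R) -> (int -> R)) (En : (int -> R) -> \bar R) : Prop :=
  forall rb eb, P2c delta rb -> P2c delta eb ->
    (Dsq delta rb eb < +oo)%E ->
    (limf_esup (fun t => (Dsq delta (S t rb) eb - Dsq delta rb eb)
                          * ((2 * t)^-1)%R%:E) (0:R)^'+
     + (lambda / 2)%R%:E * Dsq delta rb eb <= En eb - En rb)%E.

End Defs.

(* Main.v *)
(** Write [a] for the discrete Laplacian of [V] and [L r] for the Laplacian of [a r].
    Given an admissible curve [(rho, w)] from [rb] to [eb], the pair
    [rho'_s = e^(t(1-s)L) rho_s], [w'_s = e^(t(1-s)L^* ) w_s - t a rho'_s] joins
    [S^t rb] to [eb], because the Laplacian intertwines [L] with its transpose [L^*].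

    For a small step [h] the operators [1 + h L] and [1 + h L^*] have nonnegative
    entries, so the joint convexity of [p^2 / r] shows that they increase the sum of
    [w^2 / rho] at most by the factor [1 + h Lambda].  The semigroups are Poisson
    averages of the powers of these operators; hence the exponentials increase that sum
    at most by [e^(t Lambda)].  Expanding the square, the cross term of the action of
    [(rho', w')] is, after summation by parts, [2 t (E eb - E (S^t rb))].  Therefore
    [D(S^t rb, eb)^2 <= e^(t Lambda) D(rb, eb)^2 + 2 t (E eb - E (S^t rb))], and
    [E (S^t rb) >= E rb - t sup a^2] together with [Lambda >= 0] gives the claim. *)
Require Import Defs.
From mathcomp Require Import all_boot all_order all_algebra.
From mathcomp Require Import all_classical all_reals all_analysis.
From mathcomp Require Import measurable_realfun.
From mathcomp Require Import ring lra.
Set Implicit Arguments. Unset Strict Implicit. Unset Printing Implicit Defensive.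
Import Order.TTheory GRing.Theory Num.Theory.
Import numFieldNormedType.Exports.
Local Open Scope classical_set_scope.
Local Open Scope ring_scope.

(** * Sums over the integers *)

(** [S] is known only through its coordinatewise equations, so it must first be identified with the
    exponential series; the uniqueness argument reuses the transport construction itself.
    Boundedness of a makes L bounded, so that one step size h serves the whole lattice and e^(tL) =
    e^(-t/h) e^((t/h)(1 + hL)) has nonnegative Poisson weights: a one-step estimate then survives
    exponentiation. Curves are only absolutely continuous in each coordinate, and the bound on w_s
    over the lattice is not uniform in s; the limit in the series is taken under the time integral
    with the action density plus a constant as majorant. Summation by parts against V is delicate,
    because V may grow quadratically while the time-integrated momentum is only summable: V is
    replaced by V / (1 + k^2 / (n + 1)), whose Laplacian is bounded uniformly in n. Finally Lambda
    >= 0 holds because the positive function a^2 cannot be strictly concave on all of Z; this allows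
    e^(Lambda t (1 - s)) to be bounded by e^(Lambda t). *)

Definition int_of (n : nat) : int := if odd n then Negz n./2 else Posz n./2.

Lemma int_of_bij : set_bij [set: nat] [set: int] int_of.
Proof.
split => //.
- move=> m n _ _; rewrite /int_of.
  case: ifP => om; case: ifP => on // [] h.
  + by rewrite -(odd_double_half m) -(odd_double_half n) om on h.
  + by rewrite -(odd_double_half m) -(odd_double_half n) om on h.
- move=> [n|n] _ /=.
  + by exists n.*2; rewrite // /int_of odd_double doubleK.
  + by exists n.*2.+1; rewrite // /int_of /= odd_double /= uphalf_double.
Qed.

Section IntSums.
Variable R : realType.
Implicit Types (f g : int -> R) (F G : int -> \bar R).

Lemma esum_intE F : (forall k, 0 <= F k)%E ->
  \esum_(k in [set: int]) F k = (\sum_(0 <= n <oo) F (int_of n))%E.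
Proof.
by move=> F0; rewrite (reindex_esum setT setT int_of) ?nneseries_esumT//; exact: int_of_bij.
Qed.

Lemma shift_bij (j : int) : set_bij [set: int] [set: int] (fun k => k + j).
Proof.
split => //; first by move=> m n _ _ /addIr.
by move=> k _ /=; exists (k - j) => //; rewrite subrK.
Qed.

Lemma esum_shift F (j : int) :
  \esum_(k in [set: int]) F (k + j) = \esum_(k in [set: int]) F k.
Proof. by rewrite [RHS](reindex_esum setT setT (fun k => k + j))//; exact: shift_bij. Qed.

Lemma esumZl F (c : R) : 0 <= c -> (forall k, 0 <= F k)%E ->
  \esum_(k in [set: int]) (c%:E * F k)%E = (c%:E * \esum_(k in [set: int]) F k)%E.
Proof.
move=> c0 F0; rewrite !esum_intE//; last by move=> k; rewrite mule_ge0.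
by rewrite nneseriesZl.
Qed.

Lemma le_term_esum F (j : int) : (forall k, 0 <= F k)%E ->
  (F j <= \esum_(k in [set: int]) F k)%E.
Proof.
move=> F0; apply: esum_ge; exists [set j]; last by rewrite fsbig_set1.
by split.
Qed.

Lemma esum_nneseries (F : int -> nat -> \bar R) : (forall k n, 0 <= F k n)%E ->
  \esum_(k in [set: int]) (\sum_(0 <= n <oo) F k n)%E =
  (\sum_(0 <= n <oo) \esum_(k in [set: int]) F k n)%E.
Proof.
move=> F0; rewrite esum_intE; last by move=> k; exact: nneseries_ge0.
rewrite nneseries_interchange//; apply: eq_eseriesr => n _.
by rewrite esum_intE.
Qed.

Lemma integral_esum (d : measure_display) (T : measurableType d)
    (mu : {measure set T -> \bar R}) (D : set T) (F : int -> T -> \bar R) :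
  measurable D -> (forall k, measurable_fun D (F k)) ->
  (forall k x, 0 <= F k x)%E ->
  (\int[mu]_(x in D) (\esum_(k in [set: int]) F k x))%E =
  \esum_(k in [set: int]) (\int[mu]_(x in D) F k x)%E.
Proof.
move=> mD mF F0.
under eq_integral do rewrite esum_intE//.
rewrite integral_nneseries// esum_intE// => k.
exact: integral_ge0.
Qed.

Lemma measurable_esum (d : measure_display) (T : measurableType d)
    (D : set T) (F : int -> T -> \bar R) :
  measurable D -> (forall k, measurable_fun D (F k)) ->
  (forall k x, 0 <= F k x)%E ->
  measurable_fun D (fun x => \esum_(k in [set: int]) F k x).
Proof.
move=> mD mF F0.
have -> : (fun x => \esum_(k in [set: int]) F k x) =
   (fun x => \sum_(0 <= n <oo) F (int_of n) x)%E.
  by apply/funext => x; rewrite esum_intE.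
exact: ge0_emeasurable_sum.
Qed.

(** * Absolutely summable families and their real-valued sums *)

Definition summableZ f := (\esum_(k in [set: int]) `|f k|%:E < +oo)%E.

(** Encoded as an integral against counting measure along the enumeration [int_of], so that
    linearity, monotonicity and dominated convergence are inherited from integration theory. *)
Definition isum f : R := \int[counting]_n f (int_of n).

Lemma summableZP f : summableZ f <->
  counting.-integrable [set: nat] (EFin \o (f \o int_of)).
Proof.
have E : \esum_(k in [set: int]) `|f k|%:E =
   (\int[counting]_n `|(EFin \o (f \o int_of)) n|)%E.
  by rewrite esum_intE// ge0_integral_count.
split=> [h|/integrableP[_ h]]; last by rewrite /summableZ E.
by apply/integrableP; split => //; rewrite -E.
Qed.

Lemma zsum_isum f : summableZ f -> zsum f = (isum f)%:E.
Proof.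
move=> /summableZP fi; rewrite /isum /Rintegral fineK; last exact: integrable_fin_num.
rewrite integralE /zsum !ge0_integral_count//.
rewrite !esum_intE; last 2 first.
- by move=> k; rewrite lee_fin le_max lexx orbT.
- by move=> k; rewrite lee_fin le_max lexx orbT.
congr (_ - _)%E; apply: eq_eseriesr => n _ /=.
- by rewrite funeposE /= EFin_max.
- by rewrite funenegE /= EFin_max.
Qed.

Lemma zsum_ge0 f : (forall k, 0 <= f k) ->
  zsum f = \esum_(k in [set: int]) (f k)%:E.
Proof.
move=> f0; rewrite /zsum [X in (_ - X)%E]esum1 ?sube0; last first.
  by move=> k _; rewrite max_r// oppr_le0.
by apply: eq_esum => k _; rewrite max_l.
Qed.

Lemma isum_ge0E f : (forall k, 0 <= f k) -> summableZ f ->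
  (isum f)%:E = \esum_(k in [set: int]) (f k)%:E.
Proof. by move=> f0 fs; rewrite -zsum_isum// zsum_ge0. Qed.

Lemma summableZ_le f g : (forall k, `|f k| <= `|g k|) -> summableZ g -> summableZ f.
Proof.
by move=> fg; apply: le_lt_trans; apply: le_esum => k _; rewrite lee_fin.
Qed.

Lemma summableZD f g : summableZ f -> summableZ g -> summableZ (fun k => f k + g k).
Proof.
move=> /summableZP fs /summableZP gs; apply/summableZP.
exact: (integrableD measurableT fs gs).
Qed.

Lemma summableZZ (c : R) f : summableZ f -> summableZ (fun k => c * f k).
Proof.
move=> /summableZP fs; apply/summableZP.
exact: (integrableZl measurableT c fs).
Qed.

Lemma summableZ_shift f (j : int) : summableZ f -> summableZ (fun k => f (k + j)).
Proof. by rewrite /summableZ (esum_shift (fun k => `|f k|%:E)%E). Qed.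

Lemma isumD f g : summableZ f -> summableZ g ->
  isum (fun k => f k + g k) = isum f + isum g.
Proof.
move=> /summableZP fs /summableZP gs; rewrite /isum.
exact: (RintegralD measurableT fs gs).
Qed.

Lemma isumZ (c : R) f : summableZ f -> isum (fun k => c * f k) = c * isum f.
Proof. by move=> /summableZP fs; exact: (RintegralZl c measurableT fs). Qed.

Lemma isumB f g : summableZ f -> summableZ g ->
  isum (fun k => f k - g k) = isum f - isum g.
Proof.
move=> /summableZP fs /summableZP gs; rewrite /isum.
exact: (RintegralB measurableT fs gs).
Qed.

Lemma isum_shift f (j : int) : summableZ f -> isum (fun k => f (k + j)) = isum f.
Proof.
move=> fs; apply: EFin_inj; rewrite -!zsum_isum//; last exact: summableZ_shift.
rewrite /zsum.
by rewrite (esum_shift (fun k => (Num.max (f k) 0)%:E))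
  (esum_shift (fun k => (Num.max (- f k) 0)%:E)).
Qed.

Lemma le_isum f g : summableZ f -> summableZ g -> (forall k, f k <= g k) ->
  isum f <= isum g.
Proof. by move=> /summableZP fs /summableZP gs fg; apply: le_Rintegral. Qed.

Lemma isum_dominated_cvg (f_ : nat -> int -> R) f g :
  (forall k, f_ n k @[n --> \oo] --> f k) -> summableZ g ->
  (forall n k, `|f_ n k| <= g k) -> isum (f_ n) @[n --> \oo] --> isum f.
Proof.
move=> cf /summableZP gi fg.
have := @dominated_convergence _ _ R counting setT measurableT
  (fun n m => (f_ n (int_of m))%:E) (fun m => (f (int_of m))%:E)
  (fun m => (g (int_of m))%:E).
case => //.
- by apply: aeW => m _; apply: cvg_EFin; [exact: nearW|exact: cf].
- by apply: aeW => m n _; rewrite lee_fin.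
move=> fi _ h; apply: fine_cvg; rewrite fineK//.
exact: (integrable_fin_num measurableT fi).
Qed.

End IntSums.

(** * The action density *)

Section ActionDensity.
Variable R : realType.
Implicit Types (p r y : R) (B : \bar R).

Lemma Qf_ge0 p r : (0 <= Qf p r)%E.
Proof.
rewrite /Qf; case: ifP => r0; first by rewrite lee_fin divr_ge0 ?sqr_ge0// ltW.
by case: ifP.
Qed.

(** Completing the square: for r > 0 the gap is (p - y r)^2 / r. *)
Lemma Qf_lb p r y : 0 <= r -> ((2 * y * p - y ^+ 2 * r)%:E <= Qf p r)%E.
Proof.
rewrite le_eqVlt /Qf => /predU1P[<-|r0].
  by rewrite ltxx; case: ifP => [/eqP ->|_]; rewrite ?leey// lee_fin !mulr0 subr0.
rewrite r0 lee_fin -subr_ge0.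
have -> : p ^+ 2 / r - (2 * y * p - y ^+ 2 * r) = (p - y * r) ^+ 2 / r.
  by field; rewrite gt_eqF.
by rewrite divr_ge0 ?sqr_ge0// ltW.
Qed.

(* [Qf p r] is the supremum over [y] of [2 y p - y^2 r]; this variational form
   makes joint convexity of [Qf] immediate. *)
Lemma Qf_ub p r B : 0 <= r ->
  (forall y, (2 * y * p - y ^+ 2 * r)%:E <= B)%E -> (Qf p r <= B)%E.
Proof.
rewrite le_eqVlt /Qf => /predU1P[<-|r0] h.
  rewrite ltxx; have B0 : (0 <= B)%E by have := h 0; rewrite !mulr0 mul0r subr0.
  case: ifPn => // p0; case: B h B0 => [b| |] h B0 //.
  (* With r = 0 and p nonzero, this y gives the lower bound b + 1, so B cannot be the finite value
     b. *)
  have := h ((b + 1) / (2 * p)); rewrite mulr0 subr0 lee_fin.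
  by rewrite (_ : 2 * _ * _ = b + 1); [rewrite gerDl ler10|field].
(* The supremum is attained at y = p / r. *)
rewrite r0; have := h (p / r); congr (_%:E <= _)%E.
by field; rewrite gt_eqF.
Qed.

Lemma QfD p1 r1 p2 r2 : 0 <= r1 -> 0 <= r2 ->
  (Qf (p1 + p2) (r1 + r2) <= Qf p1 r1 + Qf p2 r2)%E.
Proof.
move=> r10 r20; apply: Qf_ub => [|y]; first exact: addr_ge0.
rewrite (_ : _ - _ = (2 * y * p1 - y ^+ 2 * r1) + (2 * y * p2 - y ^+ 2 * r2)); last by ring.
by rewrite EFinD leeD// Qf_lb.
Qed.

(** Numerator and density are scaled independently; together with [QfD] this produces the weights
    q_k^2 / q_(k+1) and q_k^2 / q_(k-1) of [Qf_step]. *)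
Lemma QfZ p r (l m : R) : 0 < m -> (Qf (l * p) (m * r) = (l ^+ 2 / m)%:E * Qf p r)%E.
Proof.
move=> m0; have mN0 : m != 0 by rewrite gt_eqF.
rewrite /Qf pmulr_rgt0//; case: ifPn => [r0|_].
  by rewrite -EFinM; congr EFin; field; rewrite mN0 gt_eqF.
rewrite mulf_eq0; have [-> /=|l0 /=] := eqVneq l 0; first by rewrite expr0n/= mul0r mul0e.
case: ifPn => _; first by rewrite mule0.
by rewrite gt0_muley// lte_fin divr_gt0// exprn_even_gt0.
Qed.

(** Expansion of the square of (p - b r) + b r. The term linear in p - b r is the source of the
    energy difference in the action. *)
Lemma Qf_shift p r (b : R) : 0 <= r ->
  (Qf p r = Qf (p - b * r) r + (2 * b * (p - b * r) + b ^+ 2 * r)%:E)%E.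
Proof.
rewrite le_eqVlt => /predU1P[<-|r0]; rewrite /Qf.
  rewrite ltxx !mulr0 subr0 addr0; case: ifPn => [/eqP ->|_]; last by rewrite addye.
  by rewrite mulr0 adde0.
by rewrite r0 -EFinD; congr EFin; field; rewrite gt_eqF.
Qed.


(** Take y to be the sign of p in [Qf_lb]. Summed over the lattice, this bounds the l^1 norm of the
    momentum by action density plus mass. *)
Lemma normr_le_Qf p r : 0 <= r -> (`|p|%:E <= Qf p r + r%:E)%E.
Proof.
move=> r0; have := @Qf_lb p r (Num.sg p) r0.
rewrite -leeBlDr//; apply: le_trans; rewrite lee_fin.
by case: sgrP => p0; nra.
Qed.

Lemma measurable_Qf (d : measure_display) (T : measurableType d) (D : set T)
    (f g : T -> R) : measurable D -> measurable_fun D f -> measurable_fun D g ->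
  measurable_fun D (fun x => Qf (f x) (g x)).
Proof.
move=> mD mf mg.
(* Where r > 0, division becomes multiplication by e^(-ln r), a composition of measurable
   functions. *)
have -> : (fun x => Qf (f x) (g x)) = (fun x =>
   if 0 < g x then (f x ^+ 2 * expR (- ln (g x)))%:E
   else if f x == 0 then 0%E else +oo%E).
  apply/funext => x; rewrite /Qf; case: ifPn => // g0.
  by rewrite expRN lnK.
have mlt : measurable_fun D (fun x => 0 < g x) by exact: measurable_fun_ltr.
apply: measurable_fun_if => //.
  apply: (measurable_funS mD); first by move=> x [].
  apply/measurable_EFinP; apply: measurable_funM; first exact: measurable_funX.
  apply: measurableT_comp => //; apply: measurableT_comp => //.
  exact: measurableT_comp.
apply: (measurable_funS mD); first by move=> x [].
apply: measurable_fun_if => //.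
exact: measurable_fun_eqr.
Qed.

End ActionDensity.

(** * Poisson averages *)

Section Poisson.
Variable R : realType.
Implicit Types (x y : R) (v w : nat -> R).

Definition pois x (n : nat) : R := expR (- x) * exp_coeff x n.

(** For v_n = A^n u with A a bounded operator this is e^(x (A - 1)) u; with A = 1 + h L and x = t /
    h it is e^(tL) u. *)
Definition psum x v : R := limn (series (fun n => pois x n * v n)).

Lemma pois_ge0 x n : 0 <= x -> 0 <= pois x n.
Proof. by move=> x0; rewrite mulr_ge0 ?expR_ge0// exp_coeff_ge0. Qed.

Lemma exp_coeffM x y n : exp_coeff (x * y) n = exp_coeff x n * y ^+ n.
Proof. by rewrite !exp_coeffE /= exprMn mulrA. Qed.

Lemma series_pois_expn x y :
  series (fun n => pois x n * y ^+ n) @ \oo --> expR (x * (y - 1)).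
Proof.
have -> : series (fun n => pois x n * y ^+ n) =
    (fun N => expR (- x) * series (exp_coeff (x * y)) N).
  apply/funext => N; rewrite /series /= mulr_sumr; apply: eq_bigr => n _.
  by rewrite exp_coeffM mulrA.
rewrite mulrBr mulr1 addrC expRD; apply: cvgM; first exact: cvg_cst.
exact: is_cvg_series_exp_coeff.
Qed.

Lemma nneseries_pois_expn x y :
  (\sum_(0 <= n <oo) (pois x n * y ^+ n)%:E)%E = (expR (x * (y - 1)))%:E.
Proof.
have h := @series_pois_expn x y.
rewrite -(cvg_lim _ h)// -EFin_lim; last by apply/cvg_ex; exists (expR (x * (y - 1))).
by congr (limn _); apply/funext => N /=; rewrite /series /= sumEFin.
Qed.

(** Base 2 is the growth in supremum norm that [Pop_bound] allows; the factorial decay of the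
    Poisson weights absorbs it. *)
Definition expn_bounded v := exists B : R, forall n, `|v n| <= B * 2 ^+ n.

Lemma expn_boundedD v w : expn_bounded v -> expn_bounded w ->
  expn_bounded (fun n => v n + w n).
Proof.
move=> [B hB] [C hC]; exists (B + C) => n.
by rewrite mulrDl (le_trans (ler_normD _ _))// lerD.
Qed.

Lemma expn_boundedZ (c : R) v : expn_bounded v -> expn_bounded (fun n => c * v n).
Proof.
move=> [B hB]; exists (`|c| * B) => n.
by rewrite normrM -mulrA ler_wpM2l.
Qed.

Lemma expn_bounded_shift v : expn_bounded v -> expn_bounded (fun n => v n.+1).
Proof. by move=> [B hB]; exists (2 * B) => n; rewrite -mulrA mulrCA -exprS. Qed.

Lemma psum_cvg x v : expn_bounded v ->
  series (fun n => pois x n * v n) @ \oo --> psum x v.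
Proof.
move=> [B hB]; apply: normed_cvg.
have B0 : 0 <= B by have := hB 0%N; rewrite expr0 mulr1; exact: le_trans.
have bnd n : `|pois x n * v n| <= expR (- x) * B * exp_coeff (`|x| * 2) n.
  have -> : `|pois x n * v n| = expR (- x) * (exp_coeff `|x| n * `|v n|).
    rewrite /pois -mulrA normrM gtr0_norm ?expR_gt0// normrM; congr (_ * (_ * _)).
    by rewrite !exp_coeffE /= normrM normrX ger0_norm// invr_ge0.
  rewrite exp_coeffM; move: (exp_coeff_ge0 n (normr_ge0 x)).
  move: (exp_coeff _ _) => e e0.
  by rewrite -!mulrA ler_pM2l ?expR_gt0// (mulrCA B) ler_wpM2l.
apply: (@series_le_cvg _ _ (fun n => expR (- x) * B * exp_coeff (`|x| * 2) n)) => //.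
- by move=> n; rewrite /= normr_ge0.
- by move=> n; rewrite !mulr_ge0 ?expR_ge0// exp_coeff_ge0// mulr_ge0.
exact: (is_cvg_seriesZ (is_cvg_series_exp_coeff _)).
Qed.

Lemma cvg_psum x v (l : R) : series (fun n => pois x n * v n) @ \oo --> l -> psum x v = l.
Proof. by move=> /cvg_lim; exact. Qed.

Lemma psumD x v w : expn_bounded v -> expn_bounded w ->
  psum x (fun n => v n + w n) = psum x v + psum x w.
Proof.
move=> bv bw; apply: cvg_psum.
have -> : series (fun n => pois x n * (v n + w n)) =
   series (fun n => pois x n * v n) \+ series (fun n => pois x n * w n).
  apply/funext => N; rewrite /series /= -big_split /=.
  by apply: eq_bigr => n _; rewrite mulrDr.
by apply: cvgD; exact: psum_cvg.
Qed.

Lemma psumZ x (c : R) v : expn_bounded v -> psum x (fun n => c * v n) = c * psum x v.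
Proof.
move=> bv; apply: cvg_psum.
have -> : series (fun n => pois x n * (c * v n)) =
   (fun N => c * series (fun n => pois x n * v n) N).
  apply/funext => N; rewrite /series /= mulr_sumr.
  by apply: eq_bigr => n _; rewrite mulrCA.
by apply: cvgM; [exact: cvg_cst|exact: psum_cvg].
Qed.

Lemma psum_ge0 x v : 0 <= x -> expn_bounded v -> (forall n, 0 <= v n) -> 0 <= psum x v.
Proof.
move=> x0 bv v0; apply: limr_ge; first by apply/cvg_ex; exists (psum x v); exact: psum_cvg.
by apply: nearW => N; rewrite /series /= sumr_ge0// => n _; rewrite mulr_ge0// pois_ge0.
Qed.

Lemma psum1 x : psum x (fun=> 1) = 1.
Proof.
apply: cvg_psum; have := @series_pois_expn x 1.
by rewrite subrr mulr0 expR0; under eq_fun do rewrite expr1n.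
Qed.

Lemma psum0 v : psum 0 v = v 0%N.
Proof.
apply: cvg_psum; apply: cvg_near_cst; exists 1%N => // -[//|N] _.
rewrite /series /= big_nat_recl//= big1 => [|n _].
  by rewrite /pois oppr0 expR0 exp_coeffE /= expr0 fact0 invr1 !mul1r addr0.
by rewrite /pois exp_coeffE /= expr0n /= mulr0 mulr0 mul0r.
Qed.

(** Jensen's inequality with infinitely many terms: Q is a supremum of functions linear in (p, r),
    each of which commutes with the series, so it is enough to bound partial sums for one y at a
    time. *)
Lemma Qf_psum x v w : 0 <= x -> expn_bounded v -> expn_bounded w ->
  (forall n, 0 <= w n) ->
  (Qf (psum x v) (psum x w) <= \sum_(0 <= n <oo) (pois x n)%:E * Qf (v n) (w n))%E.
Proof.
move=> x0 bv bw w0; apply: Qf_ub => [|y]; first exact: psum_ge0.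
set B := (X in (_ <= X)%E).
have -> : 2 * y * psum x v - y ^+ 2 * psum x w =
   psum x (fun n => 2 * y * v n + (- y ^+ 2) * w n).
  by rewrite psumD; [|exact: expn_boundedZ..]; rewrite !psumZ// mulNr.
have bz : expn_bounded (fun n => 2 * y * v n + (- y ^+ 2) * w n).
  by apply: expn_boundedD; exact: expn_boundedZ.
have hN N : ((series (fun n => pois x n * (2 * y * v n + (- y ^+ 2) * w n)) N)%:E <= B)%E.
  rewrite /series /= -sumEFin.
  apply: le_trans (nneseries_lim_ge N _); last first.
    by move=> n _ _; rewrite mule_ge0 ?Qf_ge0// lee_fin pois_ge0.
  apply: lee_sum => n _; rewrite EFinM lee_wpmul2l ?lee_fin ?pois_ge0//.
  by rewrite mulNr Qf_lb.
have : (0 <= B)%E by apply: nneseries_ge0 => n _ _; rewrite mule_ge0 ?Qf_ge0// lee_fin pois_ge0.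
case: B hN => [b| |] hN //= _; last by rewrite leey.
rewrite lee_fin; apply: limr_le; last by apply: nearW => N; rewrite -lee_fin.
by apply/cvg_ex; eexists; exact: (@psum_cvg _ _ bz).
Qed.

End Poisson.

(** * One step of the explicit scheme and its transpose *)

(** A factor y per step turns into e^(x (y - 1)), the generating function of the Poisson law. An
    infinite s is treated apart, where the positive prefactor makes the bound trivial. *)
Lemma nneseries_pois_le (R : realType) (x y : R) (f : nat -> \bar R) (s : \bar R) :
  0 <= x -> 0 <= y -> (0 <= s)%E -> (forall n, 0 <= f n)%E ->
  (forall n, f n <= (pois x n)%:E * ((y ^+ n)%:E * s))%E ->
  (\sum_(0 <= n <oo) f n <= (expR (x * (y - 1)))%:E * s)%E.
Proof.
move=> x0 y0 s0 f0 fs; apply: le_trans (lee_nneseries _ _) _.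
- by move=> n _ _; exact: f0.
- by move=> n _; exact: fs.
case: s s0 {fs} => [s| |] s0 //; last by rewrite gt0_muley ?leey// lte_fin expR_gt0.
rewrite -nneseries_pois_expn muleC -nneseriesZl; last first.
- by move=> n _; rewrite lee_fin mulr_ge0 ?pois_ge0// exprn_ge0.
rewrite le_eqVlt; apply/orP; left; apply/eqP; apply: eq_eseriesr => n _.
by rewrite -!EFinM mulrA mulrC.
Qed.

Section Operators.
Variables (R : realType) (q : int -> R).
Implicit Types (r u : int -> R).

(** With q_k = h a_k / delta^2 this is 1 + h L: one step for the law of the random walk jumping from
    k to each neighbour with probability q_k. Its transpose [Top] averages a function over the
    jumps. *)
Definition Pop r : int -> R := fun k =>
  (1 - 2 * q k) * r k + q (k + 1) * r (k + 1) + q (k - 1) * r (k - 1).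

Definition Top u : int -> R := fun k =>
  (1 - 2 * q k) * u k + q k * (u (k + 1) + u (k - 1)).

Hypothesis q0 : forall k, 0 < q k.
Hypothesis q4 : forall k, q k <= 4^-1.

Let q2 k : 0 < 1 - 2 * q k.
Proof. by have := q4 k; lra. Qed.

Lemma Pop_ge0 r : (forall k, 0 <= r k) -> forall k, 0 <= Pop r k.
Proof. by move=> r0 k; rewrite !addr_ge0// mulr_ge0// ltW. Qed.

Lemma iter_Pop_ge0 r n : (forall k, 0 <= r k) -> forall k, 0 <= iter n Pop r k.
Proof. by move=> r0; elim: n => //= n IH; exact: Pop_ge0. Qed.

(** Unlike the mass, the supremum is not preserved: the three coefficients add up to at most 1 + 1/4
    + 1/4. *)
Lemma Pop_bound r (B : R) : (forall k, `|r k| <= B) -> forall k, `|Pop r k| <= B * 2.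
Proof.
move=> rB k; have B0 : 0 <= B by exact: le_trans (rB 0).
have h c j : 0 <= c -> `|c * r j| <= c * B.
  by move=> c0; rewrite normrM ger0_norm// ler_wpM2l.
rewrite /Pop (le_trans (ler_normD _ _))//.
apply: (@le_trans _ _ ((1 - 2 * q k) * B + q (k + 1) * B + q (k - 1) * B)).
  rewrite lerD//; last by rewrite h// ltW.
  by rewrite (le_trans (ler_normD _ _))// lerD// h// ltW.
have := q4 (k + 1); have := q4 (k - 1); have := q0 k => *.
rewrite -!mulrDl mulrC ler_wpM2l//; lra.
Qed.

Lemma Top_bound u (B : R) : (forall k, `|u k| <= B) -> forall k, `|Top u k| <= B.
Proof.
move=> uB k; have B0 : 0 <= B by exact: le_trans (uB 0).
rewrite /Top (le_trans (ler_normD _ _))//.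
rewrite !normrM (ger0_norm (ltW (q2 k))) (ger0_norm (ltW (q0 k))).
apply: (@le_trans _ _ ((1 - 2 * q k) * B + q k * (B + B))); last first.
  by rewrite le_eqVlt; apply/orP; left; apply/eqP; ring.
rewrite lerD// ler_wpM2l// ?(ltW (q2 k)) ?(ltW (q0 k))//.
by rewrite (le_trans (ler_normD _ _))// lerD.
Qed.

Lemma iter_Pop_bound r (B : R) n : (forall k, `|r k| <= B) ->
  forall k, `|iter n Pop r k| <= B * 2 ^+ n.
Proof.
move=> rB; elim: n => [k|n IH k]; first by rewrite expr0 mulr1 rB.
by rewrite exprSr mulrA /=; exact: Pop_bound.
Qed.

Lemma iter_Top_bound u (B : R) n : (forall k, `|u k| <= B) ->
  forall k, `|iter n Top u k| <= B.
Proof. by move=> uB; elim: n => //= n IH k; exact: Top_bound. Qed.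

Lemma expn_bounded_Pop r (B : R) k : (forall k, `|r k| <= B) ->
  expn_bounded (fun n => iter n Pop r k).
Proof. by move=> rB; exists B => n; exact: iter_Pop_bound. Qed.

Lemma expn_bounded_Top u (B : R) k : (forall k, `|u k| <= B) ->
  expn_bounded (fun n => iter n Top u k).
Proof.
move=> uB; exists B => n; apply: le_trans (iter_Top_bound n uB k) _.
rewrite ler_peMr//; first exact: le_trans (uB 0).
by rewrite exprn_ege1// ler1n.
Qed.

(** Convexity of the square, after which each of the three weights is bounded by 1. The crude factor
    3 suffices, since the estimate only serves to keep the transported momentum in l^2. *)
Lemma esum_sqr_Top u :
  (\esum_(k in [set: int]) (Top u k ^+ 2)%:E <=
   3%:E * \esum_(k in [set: int]) (u k ^+ 2)%:E)%E.
Proof.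
apply: (@le_trans _ _ (\esum_(k in [set: int])
    ((u k ^+ 2)%:E + ((u (k + 1) ^+ 2)%:E + (u (k - 1) ^+ 2)%:E))%E)).
  apply: le_esum => k _; rewrite -!EFinD lee_fin /Top.
  have := q4 k; have := q0 k; move: (q k) (u k) (u (k+1)) (u (k-1)) => p a b c p0 p4.
  have -> : (1 - 2 * p) * a + p * (b + c) =
    (1 - 2 * p) * a + p * b + p * c by ring.
  (* The difference is the variance of a, b, c under the weights 1 - 2p, p, p, written as a weighted
     sum of squared pairwise differences. *)
  have J : ((1 - 2 * p) * a + p * b + p * c) ^+ 2 <=
       (1 - 2 * p) * a ^+ 2 + p * b ^+ 2 + p * c ^+ 2.
    rewrite -subr_ge0 (_ : _ - _ = (1 - 2 * p) * p * (a - b) ^+ 2 +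
       (1 - 2 * p) * p * (a - c) ^+ 2 + p ^+ 2 * (b - c) ^+ 2); last by ring.
    have q2' : 0 <= 1 - 2 * p by lra.
    by rewrite !addr_ge0// mulr_ge0 ?sqr_ge0// mulr_ge0// ltW.
  apply: le_trans J _; rewrite addrA !lerD// ler_piMl ?sqr_ge0//; lra.
rewrite !esumD; do ?by move=> k _; rewrite ?adde_ge0// lee_fin sqr_ge0.
rewrite (esum_shift (fun k => (u k ^+ 2)%:E)) (esum_shift (fun k => (u k ^+ 2)%:E)).
set s := \esum_(k in _) _.
have s0 : (0 <= s)%E by apply: esum_ge0 => k _; rewrite lee_fin sqr_ge0.
rewrite (_ : 3 = 1 + (1 + 1)) ?EFinD; last by ring.
by rewrite !ge0_muleDl ?adde_ge0// !mul1e.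
Qed.

(** [QfD] separates the three contributions; [QfZ] with l = q_k and m = q_(k+1) or q_(k-1) extracts
    the mismatch between the coefficients of [Top] and [Pop]. *)
Lemma Qf_step u r k : (forall k, 0 <= r k) ->
  (Qf (Top u k) (Pop r k) <=
   (1 - 2 * q k)%:E * Qf (u k) (r k) +
   ((q k ^+ 2 / q (k + 1))%R%:E * Qf (u (k + 1)%R) (r (k + 1)%R) +
    (q k ^+ 2 / q (k - 1))%:E * Qf (u (k - 1)%R) (r (k - 1)%R)))%E.
Proof.
move=> r0; rewrite /Top /Pop mulrDr -addrA.
have rq c j : 0 < c -> 0 <= c * r j by move=> c0; rewrite mulr_ge0// ltW.
apply: le_trans (QfD _ _ _ _) _; [exact: rq|by rewrite addr_ge0 ?rq|].
apply: leeD; first by rewrite QfZ// (_ : _ / _ = 1 - 2 * q k)// expr2 mulfK// gt_eqF.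
apply: le_trans (QfD _ _ _ _) _; [exact: rq|exact: rq|].
by rewrite !QfZ.
Qed.

Variable kap : R.
Hypothesis kap0 : 0 <= kap.
Hypothesis qkap : forall k, q (k + 1) ^+ 2 + q (k - 1) ^+ 2 - 2 * q k ^+ 2 <= kap * q k.

(* After reindexing, [Qf (u k) (r k)] is collected with the weight
   [1 - 2 q_k + (q_(k-1)^2 + q_(k+1)^2) / q_k <= 1 + kap]. *)
Lemma esum_Qf_step u r : (forall k, 0 <= r k) ->
  (\esum_(k in [set: int]) Qf (Top u k) (Pop r k) <=
   (1 + kap)%:E * \esum_(k in [set: int]) Qf (u k) (r k))%E.
Proof.
move=> r0.
apply: le_trans; first by apply: le_esum => k _; exact: Qf_step.
have Z c j : 0 <= c -> (0 <= c%:E * Qf (u j) (r j))%E.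
  by move=> c0; rewrite mule_ge0 ?Qf_ge0.
have qq i j : 0 <= q i ^+ 2 / q j by rewrite divr_ge0 ?sqr_ge0// ltW.
have q2' k : 0 <= 1 - 2 * q k by exact: ltW.
rewrite !esumD; do ?by move=> k _; rewrite ?adde_ge0// Z.
have -> : \esum_(k in [set: int]) ((q k ^+ 2 / q (k + 1))%:E * Qf (u (k + 1)%R) (r (k + 1)%R))%E =
  \esum_(k in [set: int]) ((q (k - 1) ^+ 2 / q k)%:E * Qf (u k) (r k))%E.
  rewrite -[RHS](esum_shift _ 1); apply: eq_esum => k _.
  by rewrite addrK.
have -> : \esum_(k in [set: int]) ((q k ^+ 2 / q (k - 1))%:E * Qf (u (k - 1)%R) (r (k - 1)%R))%E =
  \esum_(k in [set: int]) ((q (k + 1) ^+ 2 / q k)%:E * Qf (u k) (r k))%E.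
  rewrite -[RHS](esum_shift _ (- 1)); apply: eq_esum => k _.
  by rewrite subrK.
rewrite -!esumD; do ?by move=> k _; rewrite ?adde_ge0// Z.
rewrite -esumZl ?addr_ge0//; last by move=> k; exact: Qf_ge0.
apply: le_esum => k _; rewrite -!ge0_muleDl ?adde_ge0 ?lee_fin//.
rewrite -!EFinD lee_wpmul2r ?Qf_ge0// lee_fin.
have qk := q0 k; have -> : 1 - 2 * q k + (q (k - 1) ^+ 2 / q k + q (k + 1) ^+ 2 / q k) =
  1 + (q (k + 1) ^+ 2 + q (k - 1) ^+ 2 - 2 * q k ^+ 2) / q k.
  by field; rewrite gt_eqF.
by rewrite lerD2l ler_pdivrMr.
Qed.

Lemma esum_Qf_iter u r n : (forall k, 0 <= r k) ->
  (\esum_(k in [set: int]) Qf (iter n Top u k) (iter n Pop r k) <=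
   ((1 + kap) ^+ n)%:E * \esum_(k in [set: int]) Qf (u k) (r k))%E.
Proof.
move=> r0; elim: n => [|n IH]; first by rewrite expr0 mul1e.
rewrite exprS EFinM -muleA /=.
apply: le_trans (esum_Qf_step _ _) _; first exact: iter_Pop_ge0.
by rewrite lee_wpmul2l// lee_fin addr_ge0.
Qed.

Lemma esum_Qf_psum x u r (B : R) : 0 <= x -> (forall k, 0 <= r k) ->
  (forall k, `|u k| <= B) -> (forall k, `|r k| <= B) ->
  (\esum_(k in [set: int])
     Qf (psum x (fun n => iter n Top u k)) (psum x (fun n => iter n Pop r k)) <=
   (expR (x * kap))%:E * \esum_(k in [set: int]) Qf (u k) (r k))%E.
Proof.
move=> x0 r0 uB rB.
have px n : (0 <= (pois x n)%:E)%E by rewrite lee_fin pois_ge0.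
apply: le_trans.
  apply: le_esum => k _; apply: Qf_psum => //.
  - exact: expn_bounded_Top uB.
  - exact: expn_bounded_Pop rB.
  - by move=> n; exact: iter_Pop_ge0.
rewrite esum_nneseries; last by move=> k n; rewrite mule_ge0 ?Qf_ge0.
have -> : kap = 1 + kap - 1 by rewrite addrAC subrr add0r.
apply: nneseries_pois_le => //; first by rewrite addr_ge0.
- by apply: esum_ge0 => k _; exact: Qf_ge0.
- by move=> n; apply: esum_ge0 => k _; rewrite mule_ge0 ?Qf_ge0.
move=> n; rewrite esumZl ?pois_ge0//; last by move=> k; exact: Qf_ge0.
by rewrite lee_wpmul2l// esum_Qf_iter.
Qed.

(** A square is Q with density 1, and the Poisson weights sum to 1, so [Qf_psum] acts as Jensen's
    inequality for squares. The 2 in the exponent is 3 - 1, with the 3 of [esum_sqr_Top]. *)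
Lemma esum_sqr_psum x u (B : R) : 0 <= x -> (forall k, `|u k| <= B) ->
  (\esum_(k in [set: int]) ((psum x (fun n => iter n Top u k)) ^+ 2)%:E <=
   (expR (x * 2))%:E * \esum_(k in [set: int]) (u k ^+ 2)%:E)%E.
Proof.
move=> x0 uB.
have Q1 (p : R) : Qf p 1 = (p ^+ 2)%:E by rewrite /Qf ltr01 divr1.
have S0 (v : int -> R) : (0 <= \esum_(k in [set: int]) (v k ^+ 2)%:E)%E.
  by apply: esum_ge0 => k _; rewrite lee_fin sqr_ge0.
have b1 : expn_bounded (fun=> 1 : R).
  by exists 1 => n; rewrite normr1 mul1r exprn_ege1// ler1n.
have it n : (\esum_(k in [set: int]) (iter n Top u k ^+ 2)%:E <=
   (3 ^+ n)%:E * \esum_(k in [set: int]) (u k ^+ 2)%:E)%E.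
  elim: n => [|n IH]; first by rewrite expr0 mul1e.
  rewrite exprS EFinM -muleA /=; apply: le_trans (esum_sqr_Top _) _.
  by rewrite lee_wpmul2l.
apply: le_trans.
  apply: le_esum => k _; rewrite -Q1 -(psum1 x); apply: Qf_psum => //.
  exact: expn_bounded_Top uB.
rewrite esum_nneseries; last by move=> k n; rewrite mule_ge0 ?Qf_ge0// lee_fin pois_ge0.
have -> : 2 = 3 - 1 :> R by ring.
apply: nneseries_pois_le => //.
- by move=> n; apply: esum_ge0 => k _; rewrite mule_ge0 ?Qf_ge0// lee_fin pois_ge0.
move=> n; under eq_esum do rewrite Q1.
rewrite esumZl ?pois_ge0//; last by move=> k; rewrite lee_fin sqr_ge0.
by rewrite lee_wpmul2l// lee_fin pois_ge0.
Qed.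

End Operators.

(** * Absolutely continuous functions on the unit interval *)

Section AbsolutelyContinuous.
Variable R : realType.
Local Notation mu := (@lebesgue_measure R).
Local Notation I := (`[0%R, 1%R]%classic : set R).
Implicit Types (f g : R -> R) (s t : R).

Lemma integrable_bounded_mul (D : set R) (f g : R -> R) (K : R) :
  measurable D -> measurable_fun D f -> (forall x, D x -> `|f x| <= K) ->
  mu.-integrable D (EFin \o g) -> mu.-integrable D (EFin \o (fun x => f x * g x)).
Proof.
move=> mD mf fK ig.
apply: (@le_integrable _ _ R mu D mD _ (fun x => (K%:E * (EFin \o g) x)%E)).
- apply/measurable_EFinP; apply: measurable_funM => //.
  by apply/measurable_EFinP; exact: measurable_int ig.
- move=> x Dx /=; rewrite lee_fin !normrM ler_wpM2r//.
  by rewrite (le_trans (fK _ Dx))// ler_norm.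
exact: integrableZl.
Qed.

Lemma integrable_cst_itv (b1 b2 : bool) s t (c : R) :
  mu.-integrable [set` Interval (BSide b1 s) (BSide b2 t)] (EFin \o (fun=> c)).
Proof.
apply/integrableP; split; first by apply/measurable_EFinP; exact: measurable_cst.
rewrite [X in (X < _)%E](_ : _ = \int[mu]_(x in [set` Interval (BSide b1 s) (BSide b2 t)])
  cst `|c|%:E x)%E//.
rewrite integral_cst//= lte_mul_pinfty// lebesgue_measure_itv /=.
by case: ifP => _; rewrite ?ltry// -EFinD ltry.
Qed.

Lemma Rintegral_cst_itv s t (c : R) : s <= t ->
  \int[mu]_(x in `]s, t]) c = c * (t - s).
Proof.
move=> st; transitivity (c * fine (mu `]s, t]%classic)); first exact: Rintegral_cst.
rewrite lebesgue_measure_itv /= lte_fin; case: ifPn => //.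
by rewrite -leNgt => ts; rewrite (le_anti (_ : s <= t <= s)) ?subrr// st.
Qed.

(** The derivative is asked to be integrable only, which keeps the class stable under the products
    and dominated limits below; square integrability is restored separately for the final curve. *)
Definition ac f g := mu.-integrable I (EFin \o g) /\
  forall t, 0 <= t <= 1 -> f t = f 0 + \int[mu]_(s in `[0%R, t]) g s.

Lemma integrable_itv g s t : 0 <= s -> t <= 1 -> mu.-integrable I (EFin \o g) ->
  mu.-integrable `[s, t] (EFin \o g) /\ mu.-integrable `]s, t] (EFin \o g).
Proof.
move=> s0 t1 ig; split; apply: integrableS ig => //.
- by apply: subset_itv; rewrite bnd_simp.
- by apply: subset_itv; rewrite bnd_simp.
Qed.

Lemma Rintegral_itv_sub g s t : 0 <= s -> s <= t -> t <= 1 ->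
  mu.-integrable I (EFin \o g) ->
  \int[mu]_(x in `[0%R, t]) g x - \int[mu]_(x in `[0%R, s]) g x =
  \int[mu]_(x in `]s, t]) g x.
Proof.
move=> s0 st t1 ig; apply: Rintegral_itvB; rewrite ?bnd_simp//.
exact: (integrable_itv _ t1 ig).1.
Qed.

Lemma ac_incr f g s t : ac f g -> 0 <= s -> s <= t -> t <= 1 ->
  f t - f s = \int[mu]_(x in `]s, t]) g x.
Proof.
move=> [ig fg] s0 st t1; rewrite -Rintegral_itv_sub// fg; last by rewrite (le_trans s0 st).
by rewrite (fg s) ?s0 ?(le_trans st)//; ring.
Qed.

Lemma Rintegral_itv0 g : \int[mu]_(x in `[0%R, 0%R]) g x = 0.
Proof. by rewrite set_itv1 Rintegral_set1. Qed.

Lemma ac_continuous f g : ac f g -> {within I, continuous f}.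
Proof.
move=> [ig fg].
have c := @parameterized_integral_continuous R 0 1 g ler01 ig.
have E : {in I, (fun t => f 0 + parameterized_integral mu 0 t g) =1 f}.
  by move=> t; rewrite inE /= in_itv /= => tI; rewrite (fg t).
apply: (subspace_eq_continuous E).
by move=> t; apply: cvgD; [exact: cvg_cst|exact: c].
Qed.

Lemma ac_measurable f g : ac f g -> measurable_fun I f.
Proof.
move=> fg; apply: subspace_continuous_measurable_fun => //; exact: ac_continuous fg.
Qed.

Lemma ac_bounded f g : ac f g -> exists B, forall t, I t -> `|f t| <= B.
Proof.
move=> fg; have [ig h] := fg.
exists (`|f 0| + \int[mu]_(x in I) `|g x|) => t /=; rewrite in_itv /= => /andP[t0 t1].
have it := (integrable_itv (lexx 0) t1 ig).1.
rewrite h ?t0// (le_trans (ler_normD _ _))// lerD2l (le_trans (le_normr_Rintegral _ it))//.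
rewrite -subr_ge0 Rintegral_itv_sub ?Rintegral_ge0//.
exact: integrable_abse ig.
Qed.

Lemma acD f1 g1 f2 g2 : ac f1 g1 -> ac f2 g2 ->
  ac (fun t => f1 t + f2 t) (fun t => g1 t + g2 t).
Proof.
move=> [i1 h1] [i2 h2]; split=> [|t tI]; first exact: (integrableD _ i1 i2).
have /andP[t0 t1] := tI.
rewrite RintegralD//; last 2 first.
- exact: (integrable_itv (lexx 0) t1 i1).1.
- exact: (integrable_itv (lexx 0) t1 i2).1.
by rewrite h1// h2//; ring.
Qed.

Lemma acZ (c : R) f g : ac f g -> ac (fun t => c * f t) (fun t => c * g t).
Proof.
move=> [i h]; split=> [|t tI]; first exact: (integrableZl _ c i).
have /andP[t0 t1] := tI.
rewrite RintegralZl//; last exact: (integrable_itv (lexx 0) t1 i).1.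
by rewrite h// mulrDr.
Qed.

Lemma ac_sum (n : nat) (f g : nat -> R -> R) : (forall i, ac (f i) (g i)) ->
  ac (fun t => \sum_(0 <= i < n) f i t) (fun t => \sum_(0 <= i < n) g i t).
Proof.
move=> h; elim: n => [|n IH].
  have E (F : nat -> R -> R) : (fun t => \sum_(0 <= i < 0) F i t) = (fun=> 0).
    by apply/funext => t; rewrite big_geq.
  rewrite !E; split=> [|t tI]; first exact: integrable0.
  by rewrite Rintegral_cst// mul0r addr0.
have -> : (fun t => \sum_(0 <= i < n.+1) f i t) =
  (fun t => \sum_(0 <= i < n) f i t + f n t).
  by apply/funext => t; rewrite big_nat_recr.
have -> : (fun t => \sum_(0 <= i < n.+1) g i t) =
  (fun t => \sum_(0 <= i < n) g i t + g n t).
  by apply/funext => t; rewrite big_nat_recr.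
exact: acD.
Qed.

(* Summing the hypothesis over [m] equal subintervals gives
   [|X t - X 0| <= C t / m * (G t - G 0)]. *)
Lemma constant_of_small_increments (X G : R -> R) (C : R) : 0 <= C ->
  (forall s t, 0 <= s -> s <= t -> t <= 1 ->
    `|X t - X s| <= C * (t - s) * (G t - G s)) ->
  forall t, 0 <= t <= 1 -> X t = X 0.
Proof.
move=> C0 h t /andP[t0 t1].
have bnd m : `|X t - X 0| <= C * (t / m.+1%:R) * (G t - G 0).
  pose p (i : nat) : R := t * (i%:R / m.+1%:R).
  have m0 : 0 < m.+1%:R :> R by rewrite ltr0n.
  have pm : p m.+1 = t by rewrite /p divff ?mulr1// gt_eqF.
  have p0 : p 0%N = 0 by rewrite /p mul0r mulr0.
  have dp i : p i.+1 - p i = t / m.+1%:R.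
    by rewrite /p -mulrBr -mulrBl -natrB// subSnn mul1r.
  have pge i : 0 <= p i by rewrite /p mulr_ge0// divr_ge0.
  have ple i : (i < m.+1)%N -> p i.+1 <= 1.
    move=> im; rewrite /p (le_trans _ t1)// ler_piMr// ler_pdivrMr// mul1r ler_nat//.
  have tel (F : R -> R) : F t - F 0 = \sum_(0 <= i < m.+1) (F (p i.+1) - F (p i)).
    by rewrite (telescope_sumr (F \o p))//= pm p0.
  rewrite (tel X) (tel G).
  rewrite mulr_sumr (le_trans (ler_norm_sum _ _ _))// ler_sum_nat// => i /andP[_ im] /=.
  rewrite -(dp i) h//; last exact: ple.
  by rewrite -subr_ge0 dp divr_ge0.
apply/eqP; rewrite -subr_eq0 -normr_eq0 eq_le normr_ge0 andbT.
apply/ler_addgt0Pl => e e0; rewrite addr0.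
set A := C * t * (G t - G 0).
have A0 : 0 <= A by have := le_trans (normr_ge0 _) (bnd 0%N); rewrite divr1.
have := archi_boundP (divr_ge0 A0 (ltW e0)); set N := Num.bound _ => hN.
apply: (le_trans (bnd N)); rewrite (_ : _ * _ = A / N.+1%:R); last by rewrite mulrA mulrAC.
rewrite ler_pdivrMr ?ltr0n// mulrC -ler_pdivrMr// (le_trans (ltW hN))// ler_nat//.
Qed.

(** The function X, equal to p f minus the integral of dp f + p g, is constant because its increment
    over ]s, t] is of second order: at most 2 K (t - s) times the integral of |g| there. No almost
    everywhere differentiation is involved. *)
Lemma acM (p dp f g : R -> R) (K : R) : ac p dp -> (forall t, I t -> `|dp t| <= K) ->
  ac f g -> ac (fun t => p t * f t) (fun t => dp t * f t + p t * g t).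
Proof.
move=> hp dpK hf; have [idp _] := hp; have [ig _] := hf.
have [Bp pB] := ac_bounded hp; have [Bf fB] := ac_bounded hf.
have mp := ac_measurable hp; have mf := ac_measurable hf.
have mdp : measurable_fun I dp by apply/measurable_EFinP; exact: measurable_int idp.
have K0 : 0 <= K by rewrite (le_trans _ (dpK 0 _))//= in_itv /= lexx ler01.
have i1 : mu.-integrable I (EFin \o (fun t => dp t * f t)).
  under [X in EFin \o X]eq_fun do rewrite mulrC.
  exact: (integrable_bounded_mul _ mf fB).
have i2 : mu.-integrable I (EFin \o (fun t => p t * g t)).
  exact: (integrable_bounded_mul _ mp pB).
have i12 : mu.-integrable I (EFin \o (fun t => dp t * f t + p t * g t)).
  exact: (integrableD _ i1 i2).
have iag : mu.-integrable I (EFin \o (fun t => `|g t|)) by exact: integrable_abse ig.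
split=> // t tI.
pose h t := dp t * f t + p t * g t.
pose X t := p t * f t - \int[mu]_(s in `[0%R, t]) h s.
suff : X t = X 0 by rewrite /X Rintegral_itv0 /h => /eqP; rewrite subr_eq subr0 => /eqP.
move: t tI; apply: (@constant_of_small_increments X
  (fun t => \int[mu]_(s in `[0%R, t]) `|g s|) (2 * K)); first by rewrite mulr_ge0.
move=> s t s0 st t1; rewrite Rintegral_itv_sub//.
have sub r : `]s, t]%classic r -> I r.
  by rewrite /= !in_itv /= => /andP[sr rt]; rewrite (le_trans s0 (ltW sr)) (le_trans rt).
have mst : measurable (`]s, t]%classic : set R) by [].
have loc k : mu.-integrable I (EFin \o k) -> mu.-integrable `]s, t] (EFin \o k).
  by move=> ik; exact: (integrable_itv s0 t1 ik).2.
(* Writing p(t) f(t) - p(s) f(s) as p(t) (f(t) - f(s)) + f(s) (p(t) - p(s)) leaves this integrand.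
   Each product contains an increment inside ]s, t] and contributes K (t - s) [Gst], whence the 2
   K. *)
pose k r := (p t - p r) * g r + dp r * (f s - f r).
have ik : mu.-integrable I (EFin \o k).
  have -> : EFin \o k = EFin \o (fun r => (p t * g r + f s * dp r) - h r).
    by apply/funext => r /=; rewrite /k /h; congr EFin; ring.
  exact: (integrableB _ (integrableD _ (integrableZl _ (p t) ig) (integrableZl _ (f s) idp)) i12).
have -> : X t - X s = \int[mu]_(r in `]s, t]) k r.
  have -> : X t - X s = p t * (f t - f s) + f s * (p t - p s) -
     (\int[mu]_(s in `[0%R, t]) h s - \int[mu]_(r in `[0%R, s]) h r).
    by rewrite /X; ring.
  rewrite Rintegral_itv_sub// (ac_incr hf)// (ac_incr hp)//.
  rewrite -!RintegralZl//; [|exact: loc..].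
  rewrite -RintegralD//; last 2 first.
  - exact: (integrableZl _ _ (loc _ ig)).
  - exact: (integrableZl _ _ (loc _ idp)).
  rewrite -RintegralB//; last 2 first.
  - exact: (integrableD _ (integrableZl _ _ (loc _ ig)) (integrableZl _ _ (loc _ idp))).
  - exact: loc.
  by apply: eq_Rintegral => r _; rewrite /k /h; ring.
set Gst := \int[mu]_(r in `]s, t]) `|g r|.
have dpK' r : `]s, t]%classic r -> `|p t - p r| <= K * (t - s).
  move=> rst; have [sr rt] : s < r /\ r <= t by move: rst; rewrite /= in_itv /= => /andP.
  have r0 := le_trans s0 (ltW sr); rewrite (ac_incr hp)//.
  have ir := (integrable_itv r0 t1 idp).2.
  apply: le_trans (le_normr_Rintegral _ ir) _ => //.
  apply: (@le_trans _ _ (\int[mu]_(x in `]r, t]) K)).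
    apply: le_Rintegral => //.
    - exact: integrable_abse ir.
    - exact: integrable_cst_itv.
    - move=> x; rewrite /= in_itv /= => /andP[rx xt]; apply: dpK.
      by rewrite /= in_itv /= (le_trans r0 (ltW rx)) (le_trans xt).
  by rewrite Rintegral_cst_itv// ler_wpM2l// lerD2l lerN2 ltW.
have fG r : `]s, t]%classic r -> `|f s - f r| <= Gst.
  move=> rst; have [sr rt] : s < r /\ r <= t by move: rst; rewrite /= in_itv /= => /andP.
  rewrite distrC (ac_incr hf) ?(ltW sr) ?(le_trans rt)//.
  have ir := (integrable_itv s0 (le_trans rt t1) ig).2.
  apply: le_trans (le_normr_Rintegral _ ir) _ => //.
  rewrite /Gst -(Rintegral_itv_sub s0 st t1 iag).
  have E := Rintegral_itv_sub s0 (ltW sr) (le_trans rt t1) iag.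
  apply: (@le_trans _ _ (\int[mu]_(x in `[0%R, r]) `|g x| -
      \int[mu]_(x in `[0%R, s]) `|g x|)); first by rewrite E.
  rewrite lerD2r -subr_ge0 Rintegral_itv_sub// ?Rintegral_ge0//.
  exact: le_trans s0 (ltW sr).
have ik' := loc _ ik.
apply: le_trans (le_normr_Rintegral _ ik') _ => //.
have ib : mu.-integrable `]s, t] (EFin \o (fun r => K * (t - s) * `|g r| + K * Gst)).
  exact: (integrableD _ (integrableZl _ (K * (t - s)) (loc _ iag))
    (integrable_cst_itv false false s t (K * Gst))).
apply: (@le_trans _ _ (\int[mu]_(r in `]s, t]) (K * (t - s) * `|g r| + K * Gst))).
  apply: le_Rintegral => //; first exact: integrable_abse ik'.
  move=> r rst; rewrite /k (le_trans (ler_normD _ _))// !normrM lerD//.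
    by rewrite ler_wpM2r// dpK'.
  by rewrite ler_pM// ?fG// dpK//; exact: sub.
rewrite RintegralD//; last 2 first.
- exact: (integrableZl _ _ (loc _ iag)).
- exact: integrable_cst_itv.
rewrite RintegralZl//; last exact: loc.
rewrite Rintegral_cst_itv// -/Gst le_eqVlt; apply/orP; left; apply/eqP; ring.
Qed.

End AbsolutelyContinuous.

(** * Poisson averages along absolutely continuous curves *)

Section PoissonCurve.
Variable R : realType.
Local Notation mu := (@lebesgue_measure R).
Local Notation I := (`[0%R, 1%R]%classic : set R).

Lemma ac_derive (p dp : R -> R) : {within I, continuous p} -> {within I, continuous dp} ->
  (forall t : R, 0 < t < 1 -> is_derive t (1 : R) p (dp t)) -> ac p dp.
Proof.
move=> cp cdp dpE; split; first by apply: continuous_compact_integrable => //; exact: segment_compact.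
move=> t /andP[]; rewrite le_eqVlt => /predU1P[<- _|t0 t1]; first by rewrite Rintegral_itv0 addr0.
have sub : `[0, t] `<=` `[0%R, 1%R]%classic by apply: subset_itv; rewrite bnd_simp.
have cpt : {within `[0, t], continuous p} by exact: continuous_subspaceW cp.
have cdpt : {within `[0, t], continuous dp} by exact: continuous_subspaceW cdp.
have [_ l0 lt] := (continuous_within_itvP p t0).1 cpt.
have in01 x : x \in `]0, t[ -> 0 < x < 1.
  by rewrite in_itv /= => /andP[-> xt]; rewrite (lt_le_trans xt t1).
rewrite /Rintegral (@continuous_FTC2 R dp p 0 t t0 cdpt) /=; last 2 first.
- by split => // x /in01 /dpE [].
- by move=> x /in01 /dpE xd; rewrite derive1E derive_val.
by rewrite addrCA subrr addr0.
Qed.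

(** The value 0 at n = 0 makes the derivative rule p_n' = p_(n-1) - p_n hold for every n. *)
Definition pois_pred (x : R) (n : nat) : R := if n is m.+1 then pois x m else 0.

Lemma is_derive_pois (x : R) n :
  is_derive x (1 : R) (fun y => pois y n) (pois_pred x n - pois x n).
Proof.
have -> : (fun y => pois y n) =
    (fun y => n`!%:R^-1 *: ((expR \o (-%R : R -> R)) y * (y ^+ n))).
  by apply/funext => y; rewrite /pois exp_coeffE /= /GRing.scale /=; ring.
have d1 : is_derive x (1 : R) (expR \o (-%R : R -> R)) (expR (- x) * - 1).
  exact: is_derive1_comp.
have d2 : is_derive x (1 : R) (fun y : R => y ^+ n) (n%:R * x ^+ n.-1).
  have := @is_deriveX R _ (@id R) n x 1 1 _.
  by rewrite exprfctE /GRing.scale /= mulr1; apply.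
have D := is_deriveZ (n`!%:R^-1) (is_deriveM d1 d2).
refine (is_derive_eq D _).
rewrite /GRing.scale /= /pois /pois_pred.
case: n {d1 d2 D} => [|n]; rewrite ?exp_coeffE /=.
  by rewrite fact0 expr0; ring.
rewrite /pois !exp_coeffE /= exprS factS natrM invfM.
have : n.+1%:R != 0 :> R by rewrite pnatr_eq0.
move: (n.+1%:R) (expR (- x)) (x ^+ n) (n`!%:R^-1) => m e y z m0.
by field.
Qed.

Lemma continuous_pois n : continuous (fun x : R => pois x n).
Proof.
move=> x; apply/differentiable_continuous/derivable1_diffP.
by have [] := is_derive_pois x n.
Qed.

Lemma continuous_pois_pred n : continuous (fun x : R => pois_pred x n).
Proof. by case: n => [|n] x; [exact: cvg_cst|exact: continuous_pois]. Qed.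

Lemma ac_pois (X : R) n : ac (fun s => pois (X * (1 - s)) n)
  (fun s => - X * (pois_pred (X * (1 - s)) n - pois (X * (1 - s)) n)).
Proof.
have cX : continuous (fun s : R => X * (1 - s)).
  move=> s; apply: cvgM; first exact: cvg_cst.
  by apply: cvgB; [exact: cvg_cst|exact: cvg_id].
have cp : continuous (fun s : R => pois (X * (1 - s)) n).
  move=> s; apply: (@continuous_comp _ _ _ (fun s : R => X * (1 - s)) (fun x => pois x n)).
    exact: cX.
  exact: continuous_pois.
apply: ac_derive.
- exact: continuous_subspaceT.
- apply: continuous_subspaceT => s; apply: cvgM; first exact: cvg_cst.
  apply: cvgB; last exact: cp.
  by apply: (@continuous_comp _ _ _ (fun s : R => X * (1 - s)) (fun x => pois_pred x n));
    [exact: cX|exact: continuous_pois_pred].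
move=> s _.
have dX : is_derive s (1 : R) (fun s : R => X * (1 - s)) (- X).
  have D := is_deriveZ X (is_deriveB (is_derive_cst (1 : R) s (1 : R)) (is_derive_id s (1 : R))).
  by refine (is_derive_eq D _); rewrite /GRing.scale /= sub0r mulrN1.
have D := @is_derive1_comp R (fun y => pois y n) (fun s => X * (1 - s)) s _ _
  (is_derive_pois (X * (1 - s)) n) dX.
by refine (is_derive_eq D _); rewrite mulrC.
Qed.

Lemma series_pois_pred (x : R) (v : nat -> R) : expn_bounded v ->
  series (fun n => pois_pred x n * v n) @ \oo --> psum x (fun n => v n.+1).
Proof.
move=> bv; rewrite -cvg_shiftS /=.
have -> : (fun N => series (fun n => pois_pred x n * v n) N.+1) =
   series (fun n => pois x n * v n.+1).
  by apply/funext => N; rewrite /series /= big_nat_recl//= mul0r add0r.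
exact/psum_cvg/expn_bounded_shift.
Qed.

Lemma pois_pred_ge0 (x : R) n : 0 <= x -> 0 <= pois_pred x n.
Proof. by case: n => //= n; exact: pois_ge0. Qed.

Lemma series_ge0_le (v : nat -> R) (l : R) N : (forall n, 0 <= v n) ->
  series v @ \oo --> l -> series v N <= l.
Proof.
move=> v0 vl; rewrite -(cvg_lim _ vl)//; apply: nondecreasing_cvgn_le.
  exact: nondecreasing_series.
by apply/cvg_ex; exists l.
Qed.

(** The product rule is applied to partial sums, then dominated convergence to the integral
    identity. The parameter X (1 - s) decreases to 0, which gives the factor -X and leaves the
    original curve at s = 1. *)
Lemma ac_psum (X B : R) (f g : nat -> R -> R) (G : R -> \bar R) : 0 <= X ->
  (forall n, ac (f n) (g n)) ->
  (forall s n, I s -> `|f n s| <= B * 2 ^+ n) ->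
  (forall s, I s -> expn_bounded (g ^~ s)) ->
  mu.-integrable I G ->
  (forall s n, I s -> (`|g n s|%:E <= G s * (2 ^+ n)%:E)%E) ->
  ac (fun s => psum (X * (1 - s)) (f ^~ s))
     (fun s => psum (X * (1 - s)) (g ^~ s) -
       X * (psum (X * (1 - s)) (fun n => f n.+1 s) - psum (X * (1 - s)) (f ^~ s))).
Proof.
move=> X0 fg fB gb iG gG.
have bf s : I s -> expn_bounded (f ^~ s) by move=> Is; exists B => n; exact: fB.
pose x s := X * (1 - s).
have x0 s : I s -> 0 <= x s.
  by rewrite /= in_itv /= => /andP[s0 s1]; rewrite /x mulr_ge0// subr_ge0.
have xX s : I s -> x s <= X.
  by rewrite /= in_itv /= => /andP[s0 s1]; rewrite /x ler_piMr// lerBlDl lerDr.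
have B0 : 0 <= B.
  have /(fB 0 0%N) : I 0 by rewrite /= in_itv /= lexx ler01.
  by rewrite expr0 mulr1; apply: le_trans.
pose p n s := pois (x s) n.
pose dp n s := - X * (pois_pred (x s) n - pois (x s) n).
have dpb n : exists K, forall s, I s -> `|dp n s| <= K.
  have pb m : exists K, forall s, I s -> `|pois (x s) m| <= K by exact: ac_bounded (ac_pois X m).
  have [K hK] := pb n.
  have [K' hK'] : exists K, forall s, I s -> `|pois_pred (x s) n| <= K.
    by case: {hK} n => [|n]; [exists 0 => s _; rewrite /= normr0|exact: pb].
  exists (X * (K' + K)) => s Is; rewrite normrM normrN (ger0_norm X0) ler_wpM2l//.
  by rewrite (le_trans (ler_normB _ _))// lerD// ?hK ?hK'.
pose FN N s := \sum_(0 <= n < N) (p n s * f n s).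
pose gN N s := \sum_(0 <= n < N) (dp n s * f n s + p n s * g n s).
have acN N : ac (FN N) (gN N).
  apply: ac_sum => n; have [K hK] := dpb n.
  exact: (acM (ac_pois X n) hK (fg n)).
set F := (F in ac F _); set g' := (F in ac _ F).
have cF s : I s -> FN ^~ s @ \oo --> F s by move=> Is; apply: psum_cvg; exact: bf.
have cg s : I s -> gN ^~ s @ \oo --> g' s.
  move=> Is.
  have -> : gN ^~ s = (fun N => - X * (series (fun n => pois_pred (x s) n * f n s) N -
       series (fun n => pois (x s) n * f n s) N) +
       series (fun n => pois (x s) n * g n s) N).
    apply/funext => N; rewrite /gN /series /= big_split /=; congr (_ + _).
    rewrite -sumrB mulr_sumr; apply: eq_bigr => n _.
    by rewrite /dp -mulrA mulrBl.
  rewrite /g' addrC -mulNr; apply: cvgD; last exact/psum_cvg/gb.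
  apply: cvgM; first exact: cvg_cst.
  apply: cvgB; last exact/psum_cvg/bf.
  exact/series_pois_pred/bf.
have igN N : mu.-integrable I (EFin \o gN N) by have [] := acN N.
have mgN N : measurable_fun I (gN N) by apply/measurable_EFinP; exact: measurable_int (igN N).
have mg : measurable_fun I g' by apply: (measurable_fun_cvg mgN).
(* Against 2^n the Poisson weights sum to e^x with x <= X; the shifted weights cost one more factor
   2. *)
pose C := expR X.
have C1 s : I s -> forall N, series (fun n => pois (x s) n * 2 ^+ n) N <= C.
  move=> Is N; apply: (@le_trans _ _ (expR (x s * (2 - 1)))).
    apply: series_ge0_le; last exact: series_pois_expn.
    by move=> n; rewrite mulr_ge0 ?exprn_ge0// pois_ge0// x0.
  by rewrite ler_expR (_ : 2 - 1 = 1); [rewrite mulr1 xX|ring].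
have C2 s : I s -> forall N, series (fun n => pois_pred (x s) n * 2 ^+ n) N <= 2 * C.
  move=> Is [|N]; first by rewrite /series /= big_geq// mulr_ge0// expR_ge0.
  rewrite /series /= big_nat_recl//= mul0r add0r.
  under eq_bigr do rewrite exprS mulrCA.
  by rewrite -mulr_sumr ler_wpM2l// C1.
pose H s : \bar R := ((X * (2 * C + C) * B)%:E + C%:E * G s)%E.
have iH : mu.-integrable I H.
  apply: integrableD => //; last exact: integrableZl.
  exact: (integrable_cst_itv true false).
have domH s N : I s -> (`|(gN N s)%:E| <= H s)%E.
  move=> Is.
  have G0 : (0 <= G s)%E.
    by have := gG s 0%N Is; rewrite expr0 mule1; apply: le_trans.
  have pp n := pois_ge0 n (x0 s Is); have pp' n := pois_pred_ge0 n (x0 s Is).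
  apply: (@le_trans _ _ ((\sum_(0 <= n < N) `|dp n s * f n s|)%:E +
       \sum_(0 <= n < N) `|p n s * g n s|%:E)%E).
    rewrite sumEFin -EFinD -big_split lee_fin /= (le_trans (ler_norm_sum _ _ _))//.
    by apply: ler_sum => n _; exact: ler_normD.
  apply: leeD.
    rewrite lee_fin.
    apply: (@le_trans _ _ (\sum_(0 <= n < N)
        (X * (pois_pred (x s) n * 2 ^+ n + pois (x s) n * 2 ^+ n) * B))).
      apply: ler_sum => n _; rewrite normrM /dp normrM normrN (ger0_norm X0).
      rewrite -mulrDl !mulrA -(mulrA _ _ B) ler_pM ?mulr_ge0//; last by rewrite mulrC fB.
      rewrite ler_wpM2l// (le_trans (ler_normB _ _))//.
      by rewrite !ger0_norm.
    rewrite -mulr_suml -mulr_sumr big_split /= ler_wpM2r// ler_wpM2l// lerD//.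
    - exact: C2.
    - exact: C1.
  apply: (@le_trans _ _ (\sum_(0 <= n < N) ((pois (x s) n * 2 ^+ n)%:E * G s))%E).
    apply: lee_sum => n _; rewrite normrM EFinM /p ger0_norm// (EFinM (pois (x s) n) (2 ^+ n)) -muleA.
    by rewrite lee_wpmul2l ?lee_fin// muleC; exact: gG.
  rewrite -ge0_sume_distrl; last by move=> n _; rewrite lee_fin mulr_ge0// exprn_ge0.
  by rewrite sumEFin lee_wpmul2r// lee_fin C1.
have igI : mu.-integrable I (EFin \o g').
  have [] // := @dominated_convergence _ _ R mu I _ (fun N s => (gN N s)%:E) (EFin \o g') H.
  - by move=> N; apply/measurable_EFinP; exact: mgN.
  - by apply/measurable_EFinP; exact: mg.
  - by apply: aeW => s Is; apply: cvg_EFin; [exact: nearW|exact: cg].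
  - by apply: aeW => s N Is; exact: domH.
split => // t tI.
have It : `[0%R, t]%classic `<=` I by apply: subset_itv; rewrite bnd_simp//; case/andP: tI.
have mt : measurable (`[0%R, t]%classic : set R) by [].
have cint : (\int[mu]_(s in `[0%R, t]) gN N s) @[N --> \oo] --> \int[mu]_(s in `[0%R, t]) g' s.
  have [|||||ig _ h] := @dominated_convergence _ _ R mu _ mt (fun N s => (gN N s)%:E) (EFin \o g') H.
  - by move=> N; apply/measurable_EFinP; exact: measurable_funS (mgN N).
  - by apply/measurable_EFinP; exact: measurable_funS mg.
  - by apply: aeW => s /It Is; apply: cvg_EFin; [exact: nearW|exact: cg].
  - exact: integrableS iH.
  - by apply: aeW => s N /It Is; exact: domH.
  apply: fine_cvg; rewrite fineK//.
  exact: (integrable_fin_num _ ig).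
have I0 : I 0 by rewrite /= in_itv /= lexx ler01.
have It' : I t by rewrite /= in_itv.
apply: (@cvg_unique _ _ (FN N t @[N --> \oo])) => //; first exact: cF.
have -> : FN ^~ t = (fun N => FN N 0 + \int[mu]_(s in `[0%R, t]) gN N s).
  by apply/funext => N; have [_ ->] := acN N.
by apply: cvgD => //; exact: cF.
Qed.

End PoissonCurve.

(** * The flow on the lattice *)

Lemma ac_eq (R : realType) (f g f' g' : R -> R) :
  (forall s, `[0%R, 1%R]%classic s -> f s = f' s) ->
  (forall s, `[0%R, 1%R]%classic s -> g s = g' s) -> ac f g -> ac f' g'.
Proof.
move=> ff' gg' [ig h]; split.
  by apply: eq_integrable ig => // s; rewrite inE => Is /=; rewrite gg'.
move=> t tI; have /andP[t0 t1] := tI.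
rewrite -!ff' /= ?in_itv/= ?lexx ?ler01//; rewrite (h t tI); congr (_ + _).
apply: eq_Rintegral => s; rewrite inE /= in_itv /= => /andP[s0 st]; apply: gg'.
by rewrite /= in_itv /= s0 (le_trans st).
Qed.

Section Lattice.
Variables (R : realType) (delta : R) (V : int -> R) (M : R).
Hypothesis delta0 : 0 < delta.
Local Notation mu := (@lebesgue_measure R).
Local Notation I := (`[0%R, 1%R]%classic : set R).
Local Notation a := (dlap delta V).
Hypothesis a0 : forall k, 0 < a k.
Hypothesis aM : forall k, a k <= M.

Let M0 : 0 < M. Proof. exact: lt_le_trans (a0 0) (aM 0). Qed.

(* [qcoef] is [h a / delta^2] for the step size [h = delta^2 / (4 M)], whose inverse is
   [rate]; this choice gives [qcoef <= 1/4]. *)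
Definition qcoef (k : int) : R := a k / (4 * M).
Definition rate : R := 4 * M / delta ^+ 2.
Local Notation P := (Pop qcoef).
Local Notation T := (Top qcoef).

Lemma qcoef_gt0 k : 0 < qcoef k.
Proof. by rewrite divr_gt0// mulr_gt0. Qed.

Lemma qcoef_le k : qcoef k <= 4^-1.
Proof.
rewrite ler_pdivrMr ?mulr_gt0// mulrA mulVf// mul1r; exact: aM.
Qed.

Lemma rate_ge0 : 0 <= rate.
Proof. by rewrite divr_ge0 ?sqr_ge0// mulr_ge0// ltW. Qed.

Lemma dlap_Pop (r : int -> R) k :
  rate * (P r k - r k) = dlap delta (fun j => a j * r j) k.
Proof.
have m0 : M != 0 by rewrite gt_eqF.
rewrite /rate /Pop /qcoef {4}/dlap.
move: (a k) (a (k + 1)) (a (k - 1)) => x y z.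
by field; rewrite m0 gt_eqF.
Qed.

Lemma dlap_Top (w : int -> R) k : dlap delta (T w) k = P (dlap delta w) k.
Proof.
have e1 : k + 1 - 1 = k by rewrite addrK.
have e2 : k - 1 + 1 = k by rewrite subrK.
rewrite /Top /Pop /dlap e1 e2.
move: (qcoef k) (qcoef (k + 1)) (qcoef (k - 1)) => x y z.
by field; rewrite gt_eqF.
Qed.

Lemma iter_dlap_Top (w : int -> R) n :
  iter n P (dlap delta w) = dlap delta (iter n T w).
Proof.
elim: n => //= n IH; apply/funext => k; rewrite dlap_Top.
by congr (P _ k).
Qed.

(** As q is a constant multiple of a, a_k q_j = q_k a_j, so multiplication by a intertwines [Pop]
    and [Top]. This makes the momentum vanish in [semigroup_psum]. *)
Lemma Top_mul (r : int -> R) (t : R) k : T (fun j => t * (a j * r j)) k = t * (a k * P r k).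
Proof.
have m0 : M != 0 by rewrite gt_eqF.
rewrite /Top /Pop /qcoef; move: (a k) (a (k + 1)) (a (k - 1)) => x y z.
by field.
Qed.

Lemma iter_Top_mul (r : int -> R) (t : R) n :
  iter n T (fun j => t * (a j * r j)) = (fun j => t * (a j * iter n P r j)).
Proof. by elim: n => //= n ->; apply/funext => k; rewrite Top_mul. Qed.

Lemma dlapB (f g : int -> R) (t : R) k :
  dlap delta (fun j => f j - t * g j) k = dlap delta f k - t * dlap delta g k.
Proof. by rewrite /dlap; field; rewrite gt_eqF. Qed.

Lemma dlap_bound (w : int -> R) (B : R) : (forall k, `|w k| <= B) ->
  forall k, `|dlap delta w k| <= 4 / delta ^+ 2 * B.
Proof.
move=> wB k; rewrite /dlap normrM [X in _ * X]ger0_norm ?invr_ge0 ?sqr_ge0//.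
rewrite mulrAC ler_wpM2r ?invr_ge0 ?sqr_ge0//.
apply: le_trans (ler_normB _ _) _; rewrite normrM ger0_norm//.
have := wB k; have := ler_normD (w (k + 1)) (w (k - 1)).
by have := wB (k + 1); have := wB (k - 1); lra.
Qed.

Lemma ac_Pop (f g : R -> int -> R) : (forall k, ac (f ^~ k) (g ^~ k)) ->
  forall k, ac (fun s => P (f s) k) (fun s => P (g s) k).
Proof. by move=> h k; apply: acD; [apply: acD|]; exact: acZ. Qed.

Lemma psum_dlap (x : R) (v : nat -> int -> R) k : (forall j, expn_bounded (v ^~ j)) ->
  psum x (fun n => dlap delta (v n) k) = dlap delta (fun j => psum x (v ^~ j)) k.
Proof.
move=> bv.
have -> : (fun n => dlap delta (v n) k) = (fun n => (delta ^+ 2)^-1 *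
    (v n (k + 1) + v n (k - 1) + - 2 * v n k)).
  by apply/funext => n; rewrite /dlap mulrC mulNr.
have b2 : expn_bounded (fun n => - 2 * v n k) by exact: expn_boundedZ.
have b1 : expn_bounded (fun n => v n (k + 1) + v n (k - 1)) by exact: expn_boundedD.
rewrite psumZ; last exact: expn_boundedD.
by rewrite psumD// psumD// psumZ// /dlap mulrC mulNr.
Qed.

Lemma psum_Pop (x : R) (v : nat -> int -> R) k : (forall j, expn_bounded (v ^~ j)) ->
  psum x (fun n => P (v n) k) = P (fun j => psum x (v ^~ j)) k.
Proof.
move=> bv.
have b (c : R) j : expn_bounded (fun n => c * v n j) by exact: expn_boundedZ.
rewrite /Pop psumD//; last exact: expn_boundedD.
by rewrite psumD// !psumZ.
Qed.

(** Differentiation in s gives two terms: the exponential applied to the Laplacian of w, moved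
    inside the Laplacian by [iter_dlap_Top], and -t L of the transported density, itself a
    Laplacian. The bounds C may depend on s; [G] supplies integrability in time. *)
Lemma ac_flow (rho w : R -> int -> R) (B t : R) (G : R -> \bar R) : 0 <= t ->
  (forall k, ac (rho ^~ k) (fun s => dlap delta (w s) k)) ->
  (forall s k, I s -> `|rho s k| <= B) ->
  (forall s, I s -> exists C, forall k, `|w s k| <= C) ->
  mu.-integrable I G -> (forall s k, I s -> (`|w s k|%:E <= G s)%E) ->
  forall k, ac (fun s => psum (rate * t * (1 - s)) (fun n => iter n P (rho s) k))
    (fun s => dlap delta (fun j =>
       psum (rate * t * (1 - s)) (fun n => iter n T (w s) j) -
       t * (a j * psum (rate * t * (1 - s)) (fun n => iter n P (rho s) j))) k).
Proof.
move=> t0 hac rB wb iG wG k.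
have q0 := qcoef_gt0; have q4 := qcoef_le.
pose f n s := iter n P (rho s) k.
pose g n s := iter n P (dlap delta (w s)) k.
have gE n s : g n s = dlap delta (iter n T (w s)) k by rewrite /g iter_dlap_Top.
have e0 : 0 <= 4 / delta ^+ 2 by rewrite divr_ge0 ?sqr_ge0.
have hf n : ac (f n) (g n).
  rewrite /f /g; elim: n k {f g gE} => [|n IH] k //=.
  exact: ac_Pop.
have := @ac_psum R (rate * t) B f g (fun s => (4 / delta ^+ 2)%:E * G s)%E
  (mulr_ge0 rate_ge0 t0) hf.
have bT s j : I s -> expn_bounded (fun n => iter n T (w s) j).
  by move=> Is; have [C hC] := wb _ Is; exact: expn_bounded_Top hC.
have bP s j : I s -> expn_bounded (fun n => iter n P (rho s) j).
  by move=> Is; apply: (@expn_bounded_Pop _ _ _ _ _ B) => // i; exact: rB.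
have h1 s n : I s -> `|f n s| <= B * 2 ^+ n.
  by move=> Is; apply: iter_Pop_bound => // j; exact: rB.
have h2 s : I s -> expn_bounded (g ^~ s).
  move=> Is; have [C hC] := wb _ Is; exists (4 / delta ^+ 2 * C) => n.
  rewrite gE; apply: (@le_trans _ _ (4 / delta ^+ 2 * C)).
    by apply: dlap_bound => j; exact: iter_Top_bound.
  rewrite ler_peMr ?exprn_ege1 ?ler1n// mulr_ge0//.
  exact: le_trans (hC 0).
have h3 : mu.-integrable I (fun s => (4 / delta ^+ 2)%:E * G s)%E by exact: integrableZl.
have h4 s n : I s -> (`|g n s|%:E <= (4 / delta ^+ 2)%:E * G s * (2 ^+ n)%:E)%E.
  move=> Is; have := wG s ^~ Is; move: (G s) => y hy.
  have y0 : (0 <= y)%E by apply: le_trans (hy 0).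
  apply: (@le_trans _ _ ((4 / delta ^+ 2)%:E * y)%E); last first.
    by rewrite lee_pemulr ?mule_ge0// lee_fin exprn_ege1 ?ler1n.
  case: y y0 hy => [y| |] y0 hy //; last first.
    by rewrite gt0_muley ?leey// lte_fin divr_gt0// exprn_gt0.
  rewrite -EFinM lee_fin gE; apply: dlap_bound => j.
  by apply: iter_Top_bound.
move=> /(_ h1 h2 h3 h4); apply: ac_eq => // s Is.
have -> : psum (rate * t * (1 - s)) (g ^~ s) =
   dlap delta (fun j => psum (rate * t * (1 - s)) (fun n => iter n T (w s) j)) k.
  rewrite -psum_dlap; first by congr psum; apply/funext => n; exact: gE.
  by move=> j; exact: bT.
rewrite /f /= (@psum_Pop _ (fun n => iter n P (rho s))); last by move=> j; exact: bP.
pose Y j := psum (rate * t * (1 - s)) (fun n => iter n P (rho s) j).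
pose U j := psum (rate * t * (1 - s)) (fun n => iter n T (w s) j).
(* The derivative of the Poisson parameter contributes the left side; here [rate] cancels the step
   size. *)
have E1 : rate * t * (P Y k - Y k) = t * dlap delta (fun j => a j * Y j) k.
  by rewrite -dlap_Pop mulrCA mulrA.
by rewrite dlapB -E1.
Qed.

Lemma P2c_ge0 (rho : int -> R) k : P2c delta rho -> 0 <= rho k.
Proof. by case=> + _; exact. Qed.

Lemma P2c_mass (rho : int -> R) : P2c delta rho ->
  \esum_(k in [set: int]) (rho k)%:E = (delta^-1)%:E.
Proof.
move=> [r0 [h _]]; move: h; rewrite zsum_ge0; last by move=> k; rewrite mulr_ge0// ltW.
under eq_esum do rewrite EFinM.
rewrite esumZl ?(ltW delta0)//; set s := \esum_(k in _) _; move=> h.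
have : (0 <= s)%E by apply: esum_ge0 => k _; rewrite lee_fin.
case: s h => [s| |] //=; last by rewrite gt0_muley// lte_fin.
rewrite -EFinM => -[h] _; congr EFin.
by rewrite -[LHS]mul1r -(mulVf (lt0r_neq0 delta0)) -mulrA h mulr1.
Qed.

Lemma P2c_le (rho : int -> R) k : P2c delta rho -> `|rho k| <= delta^-1.
Proof.
move=> hr; rewrite ger0_norm; last exact: P2c_ge0 hr.
rewrite -lee_fin -(P2c_mass hr); apply: (@le_term_esum R (fun k => (rho k)%:E)) => j.
by rewrite lee_fin; exact: P2c_ge0 hr.
Qed.

(** * Identification of the given semigroup with the exponential series *)

Variable S : R -> (int -> R) -> (int -> R).
Hypothesis genS : generated_semigroup delta V S.

Lemma semigroup_continuous (r : int -> R) (t : R) k : P2c delta r -> 0 < t ->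
  {within I, continuous (fun s => S (t * s) r k)}.
Proof.
move=> hr t0; have [S0 [SP [_ /(_ k) [r0 der]]]] := genS hr.
have c (s : R) : 0 < s -> {for s, continuous (fun s => S (t * s) r k)}.
  move=> s0; apply: (@continuous_comp _ _ _ (fun s : R => t * s) (fun u => S u r k)).
    by apply: cvgM; [exact: cvg_cst|exact: cvg_id].
  apply/differentiable_continuous/derivable1_diffP.
  by have [] := der (t * s) (mulr_gt0 t0 s0).
apply/continuous_within_itvP => //; split.
- by move=> s; rewrite in_itv /= => /andP[s0 _]; exact: c.
- rewrite mulr0 S0.
  apply: (@cvg_comp _ _ _ (fun s : R => t * s) (fun u => S u r k) _ (0 : R)^'+) => //.
  move=> A [e /= e0 hA]; exists (e / t); first by rewrite /= divr_gt0.
  move=> s /= hs s0; apply: hA; last exact: mulr_gt0.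
  rewrite /ball_ /= sub0r normrN normrM (gtr0_norm t0) mulrC -ltr_pdivlMr//.
  by move: hs; rewrite sub0r normrN.
- by apply: cvg_at_left_filter; exact: c.
Qed.

Lemma semigroup_ac (r : int -> R) (t : R) k : P2c delta r -> 0 < t ->
  ac (fun s => S (t * s) r k)
     (fun s => dlap delta (fun j => t * (a j * S (t * s) r j)) k).
Proof.
move=> hr t0; apply: ac_derive; first exact: semigroup_continuous.
- have c j : {within I, continuous (fun s => t * (a j * S (t * s) r j))}.
    move=> s; apply: cvgM; first exact: cvg_cst.
    by apply: cvgM; [exact: cvg_cst|exact: semigroup_continuous].
  move=> s; apply: cvgM; last exact: cvg_cst.
  apply: cvgB; first by apply: cvgD; exact: c.
  by apply: cvgM; [exact: cvg_cst|exact: c].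
move=> s /andP[s0 _]; have [_ [_ [_ /(_ k) [_ /(_ _ (mulr_gt0 t0 s0)) der]]]] := genS hr.
have dt : is_derive s (1 : R) (fun s : R => t * s) t.
  by refine (is_derive_eq (is_deriveZ t (is_derive_id s (1 : R))) _); rewrite /GRing.scale /= mulr1.
refine (is_derive_eq (@is_derive1_comp R (fun u => S u r k) (fun s => t * s) s _ _ der dt) _).
rewrite /dlap; field; rewrite gt_eqF//.
Qed.

(** Uniqueness by Duhamel's method: the curve S^(ts) r, with momentum t a S^(ts) r, is transported
    to e^(t(1-s)L) S^(ts) r. By [Top_mul] the new momentum is zero, so the endpoints e^(tL) r and
    S^t r agree. *)
Lemma semigroup_psum (r : int -> R) (t : R) k : P2c delta r -> 0 <= t ->
  S t r k = psum (rate * t) (fun n => iter n P r k).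
Proof.
move=> hr; rewrite le_eqVlt => /predU1P[<-|t0].
  by have [-> _] := genS hr; rewrite mulr0 psum0.
have SP u : 0 <= u -> P2c delta (S u r) by have [_ [+ _]] := genS hr; exact.
have SI s : I s -> P2c delta (S (t * s) r).
  by rewrite /= in_itv /= => /andP[s0 _]; apply: SP; rewrite mulr_ge0// ltW.
pose rho s := S (t * s) r.
pose w s j := t * (a j * rho s j).
have wC s j : I s -> `|w s j| <= t * (M * delta^-1).
  move=> Is; rewrite /w normrM gtr0_norm// ler_pM2l// normrM ler_pM//.
    by rewrite gtr0_norm.
  exact/P2c_le/SI.
have rB s j : I s -> `|rho s j| <= delta^-1 by move=> Is; exact/P2c_le/SI.
have iG : mu.-integrable I (fun=> (t * (M * delta^-1))%:E) by exact: (integrable_cst_itv true false).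
have := @ac_flow rho w delta^-1 t _ (ltW t0) (fun k => semigroup_ac k hr t0) rB _ iG _ k.
have wC1 s : I s -> exists C, forall k, `|w s k| <= C.
  by move=> Is; exists (t * (M * delta^-1)) => j; exact: wC.
have wC2 s j : I s -> (`|w s j|%:E <= (t * (M * delta^-1))%:E)%E.
  by move=> Is; rewrite lee_fin wC.
move=> /(_ wC1 wC2) [_ /(_ 1)].
rewrite ler01 lexx subrr mulr0 psum0 /= subr0 mulr1 => /(_ isT).
rewrite /rho mulr1 mulr0; have [-> _] := genS hr; move=> ->.
under eq_Rintegral => s.
  rewrite inE => Is.
  have bP j : expn_bounded (fun n => iter n P (rho s) j).
    apply: (@expn_bounded_Pop _ _ qcoef_gt0 qcoef_le _ delta^-1) => i; exact: rB.
  have -> : (fun j => psum (rate * t * (1 - s)) (fun n => iter n T (w s) j) -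
     t * (a j * psum (rate * t * (1 - s)) (fun n => iter n P (S (t * s) r) j))) = (fun=> 0).
    apply/funext => j.
    have -> : (fun n => iter n T (w s) j) = (fun n => t * (a j * iter n P (rho s) j)).
      by apply/funext => n; rewrite (iter_Top_mul (rho s)).
    by rewrite psumZ ?psumZ ?subrr//; exact: expn_boundedZ.
  over.
have -> : dlap delta (fun=> 0) k = 0 by rewrite /dlap addr0 mulr0 subrr mul0r.
by rewrite Rintegral_cst// mul0r addr0.
Qed.

End Lattice.

(** * Summation by parts for the energy *)

(** Slopes of a strictly concave function decrease, so one negative slope forces negative values
    further on. Applied to b = a^2, this gives Lambda >= 0. *)
Lemma no_positive_strictly_concave (R : realType) (b : int -> R) :
  (forall k, 0 < b k) -> exists k, 0 <= b (k + 1) + b (k - 1) - 2 * b k.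
Proof.
move=> b0; apply: contrapT => /forallNP h.
have {}h k : b (k + 1) + b (k - 1) - 2 * b k < 0 by rewrite ltNge; apply/negP/h.
have dec (c : int -> R) : (forall k, 0 < c k) ->
    (forall k, c (k + 1) + c (k - 1) - 2 * c k < 0) -> c 1 < c 0 -> False.
  move=> c0 hc c10; pose d := c 0 - c 1.
  have d0 : 0 < d by rewrite subr_gt0.
  have step (n : nat) : c (n%:Z + 1) - c n%:Z <= - d.
    elim: n => [|n IH]; first by rewrite add0r /d opprB.
    have := hc (n.+1%:Z); rewrite (_ : n.+1%:Z - 1 = n%:Z); last by rewrite intS addrAC subrr add0r.
    by rewrite (_ : n%:Z + 1 = n.+1%:Z) in IH; [lra|rewrite intS addrC].
  have lin (n : nat) : c n%:Z <= c 0 - n%:R * d.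
    elim: n => [|n IH]; first by rewrite mul0r subr0.
    have := step n; rewrite (_ : n%:Z + 1 = n.+1%:Z); last by rewrite intS addrC.
    by rewrite -natr1; lra.
  have := archi_boundP (divr_ge0 (ltW (c0 0)) (ltW d0)); set N := Num.bound _.
  rewrite ltr_pdivrMr// => hN; have := lin N; have := c0 N%:Z; lra.
have [h1|h1] := ltP (b 1) (b 0); first exact: (dec b).
(* If b does not decrease from 0 to 1, strict concavity at 0 makes it decrease from 0 to -1, and
   reflection applies. *)
apply: (dec (fun k => b (- k))) => //.
- by move=> k; have := h (- k); rewrite opprD opprB (addrC 1 (- k)) [b _ + b _]addrC.
- by have := h 0; rewrite add0r sub0r oppr0; lra.
Qed.

(** * Growth of the potential, cutoffs and the discrete Green formula *)

Section Growth.
Variables (R : realType) (delta : R) (V : int -> R) (M : R).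
Hypothesis delta0 : 0 < delta.
Local Notation a := (dlap delta V).
Hypothesis a0 : forall k, 0 < a k.
Hypothesis aM : forall k, a k <= M.

Let diff2 k : V (k + 1) - V k = V k - V (k - 1) + delta ^+ 2 * a k.
Proof. by rewrite /dlap; field; rewrite gt_eqF. Qed.

Let da k : 0 <= delta ^+ 2 * a k <= delta ^+ 2 * M.
Proof. by rewrite mulr_ge0 ?sqr_ge0 ?(ltW (a0 _))//= ler_wpM2l// sqr_ge0. Qed.

(** Second differences of V lie between 0 and delta^2 M, so slopes grow at most linearly and V at
    most quadratically. *)
Lemma quadratic_growth : exists C : R, [/\ 0 <= C,
  forall k : int, `|V (k + 1) - V k| <= C * (1 + `|k%:~R|) &
  forall k : int, `|V k| <= C * (1 + k%:~R ^+ 2)].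
Proof.
pose A := `|V 1 - V 0|; pose B := delta ^+ 2 * M; pose C := `|V 0| + A + B.
have B0 : 0 <= B by have /andP[h1 h2] := da 0; exact: le_trans h2.
have A0 : 0 <= A by rewrite normr_ge0.
have C0 : 0 <= `|V 0| by rewrite normr_ge0.
have D k : `|V (k + 1) - V k| <= A + B * `|k%:~R|.
  elim/int_rect: k => [|n IH|n IH]; first by rewrite add0r normr0 mulr0 addr0.
  - have e : n.+1%:Z - 1 = n%:Z by rewrite intS addrAC subrr add0r.
    rewrite diff2 e (le_trans (ler_normD _ _))//.
    have /andP[h1 h2] := da n.+1%:Z; rewrite (ger0_norm h1).
    rewrite (_ : n%:Z + 1 = n.+1%:Z) in IH; last by rewrite intS addrC.
    move: IH h2; rewrite -/B -!pmulrn !normr_nat -natr1; lra.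
  - have e : - n.+1%:Z + 1 = - n%:Z by rewrite intS opprD addrAC addNr add0r.
    have e' : - n%:Z - 1 = - n.+1%:Z by rewrite intS opprD addrC.
    rewrite e; have := diff2 (- n%:Z); rewrite e' => hd.
    have -> : V (- n%:Z) - V (- n.+1%:Z) =
       V (- n%:Z + 1) - V (- n%:Z) - delta ^+ 2 * a (- n%:Z) by rewrite hd addrK.
    rewrite (le_trans (ler_normB _ _))//.
    have /andP[h1 h2] := da (- n%:Z); rewrite (ger0_norm h1).
    move: IH h2; rewrite -/B !mulrNz !normrN -!pmulrn !normr_nat -natr1; lra.
exists C; split; first by rewrite /C !addr_ge0.
- move=> k; apply: le_trans (D k) _.
  have := normr_ge0 (k%:~R : R); move: `|k%:~R| => x x0; rewrite /C; nra.
- elim/int_rect => [|n IH|n IH].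
  + by rewrite expr0n /= addr0 mulr1 /C; lra.
  + have e : n.+1%:Z = n%:Z + 1 by rewrite intS addrC.
    have -> : V n.+1%:Z = V n%:Z + (V (n%:Z + 1) - V n%:Z) by rewrite e addrCA subrr addr0.
    rewrite (le_trans (ler_normD _ _))//; have := D n%:Z.
    move: IH; rewrite -!pmulrn !normr_nat -natr1; have := ler0n R n.
    move: (n%:R) => x x0; rewrite /C; nra.
  + have e : - n.+1%:Z + 1 = - n%:Z by rewrite intS opprD addrAC addNr add0r.
    have -> : V (- n.+1%:Z) = V (- n%:Z) - (V (- n.+1%:Z + 1) - V (- n.+1%:Z)).
      by rewrite e opprB addrCA subrr addr0.
    rewrite (le_trans (ler_normB _ _))//; have := D (- n.+1%:Z).
    move: IH; rewrite !mulrNz !normrN !sqrrN -!pmulrn !normr_nat -natr1; have := ler0n R n.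
    move: (n%:R) => x x0; rewrite /C; nra.
Qed.

(** Quadratic growth of V makes each cutoff bounded, and the slowly varying denominator keeps the
    Laplacian bounded uniformly in n, whereas a sharp truncation would create jumps of the size of
    V. *)
Definition cutoff (n : nat) (k : int) : R := V k / (1 + n.+1%:R^-1 * k%:~R ^+ 2).

(** Here e stands for 1 / (n + 1), and v0, vp, vm for V at x, x + 1, x - 1. The 17 C is 2 C from
    [T1] plus 15 C from [T3]. *)
Lemma cutoff_real_bound (e x C m v0 vp vm : R) : 0 < e -> e <= 1 -> 0 <= C -> 0 <= m ->
  `|vp + vm - 2 * v0| <= m -> `|vp - v0| <= C * (1 + `|x|) ->
  `|v0 - vm| <= C * (1 + `|x - 1|) ->
  `|vp| <= C * (1 + (x + 1) ^+ 2) -> `|vm| <= C * (1 + (x - 1) ^+ 2) ->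
  `|vp / (1 + e * (x + 1) ^+ 2) + vm / (1 + e * (x - 1) ^+ 2) -
    2 * (v0 / (1 + e * x ^+ 2))| <= m + 17 * C.
Proof.
move=> e0 e1 C0 m0 h2 hd1 hd2 hp hm.
have D1 y : 1 <= 1 + e * y ^+ 2 by rewrite lerDl mulr_ge0 ?sqr_ge0// ltW.
have phi y v : `|v| <= C * (1 + y ^+ 2) -> e * `|v / (1 + e * y ^+ 2)| <= C.
  move=> hv; have Dy := D1 y; have Dy0 : 0 < 1 + e * y ^+ 2 by lra.
  rewrite normrM normfV (gtr0_norm Dy0) mulrA ler_pdivrMr//.
  have y0 := sqr_ge0 y; have : e * `|v| <= e * (C * (1 + y ^+ 2)) by rewrite ler_pM2l.
  by move/le_trans; apply; nra.
have Hp := phi _ _ hp; have Hm := phi _ _ hm.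
have dp1 := D1 (x + 1); have dm1 := D1 (x - 1); have d01 := D1 x.
set dp := 1 + e * (x + 1) ^+ 2 in Hp dp1 *; set dm := 1 + e * (x - 1) ^+ 2 in Hm dm1 *.
set d0 := 1 + e * x ^+ 2 in d01 *.
have dp0 : 0 < dp by lra. have dm0 : 0 < dm by lra. have d00 : 0 < d0 by lra.
set fp := vp / dp in Hp *; set fm := vm / dm in Hm *.
(* Discrete Leibniz rule for v = f d, solved for the second difference of f; that of d is 2 e. *)
have E1 : fp + fm - 2 * (v0 / d0) =
   (vp + vm - 2 * v0 - e * (fp + fm) - 2 * e * x * (fp - fm)) / d0.
  by rewrite /fp /fm /dp /dm /d0; field; rewrite !gt_eqF.
have E2 : fp - fm = (vp - vm - 4 * e * x * fm) / dp.
  by rewrite /fp /fm /dp /dm; field; rewrite !gt_eqF.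
have T1 : `|e * (fp + fm)| <= 2 * C.
  rewrite normrM gtr0_norm//; have := ler_normD fp fm => hh.
  have : e * `|fp + fm| <= e * (`|fp| + `|fm|) by rewrite ler_pM2l.
  lra.
have x0 := normr_ge0 x.
have xx : `|x| ^+ 2 = x ^+ 2 by rewrite real_normK// num_real.
have T2 : `|fp - fm| <= C * (3 + 6 * `|x|).
  rewrite E2 normrM normfV (gtr0_norm dp0) ler_pdivrMr//.
  apply: (@le_trans _ _ (C * (3 + 6 * `|x|) * 1)); last first.
    by rewrite ler_wpM2l// mulr_ge0// addr_ge0// mulr_ge0.
  rewrite mulr1 (le_trans (ler_normB _ _))//.
  have -> : vp - vm = (vp - v0) + (v0 - vm) by ring.
  have h1 := ler_normD (vp - v0) (v0 - vm).
  have h3 : `|x - 1| <= `|x| + 1 by rewrite (le_trans (ler_normB _ _))// normr1.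
  have h4 : C * `|x - 1| <= C * (`|x| + 1) by rewrite ler_wpM2l.
  have h5 : `|4 * e * x * fm| <= 4 * `|x| * C.
    have -> : `|4 * e * x * fm| = 4 * `|x| * (e * `|fm|).
      by rewrite !(normrM _ fm, normrM _ x, normrM _ e) (gtr0_norm e0) normr_nat; ring.
    by rewrite ler_wpM2l// mulr_ge0.
  lra.
have T3 : `|2 * e * x * (fp - fm)| <= 15 * C * d0.
  rewrite (normrM _ (fp - fm)) (normrM _ x) (normrM _ e) (gtr0_norm e0) normr_nat.
  apply: (@le_trans _ _ (2 * e * `|x| * (C * (3 + 6 * `|x|)))).
    by rewrite ler_wpM2l// !mulr_ge0// ltW.
  (* The 15 comes from 2 e |x| (3 + 6 |x|) <= 15 (1 + e x^2), whose gap is a sum of nonnegative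
     terms as e <= 1. *)
  rewrite /d0 -xx -subr_ge0 (_ : _ - _ = C * (3 * e * (`|x| - 1) ^+ 2 + 3 * (1 - e) + 12)); last by ring.
  have s1 := sqr_ge0 (`|x| - 1).
  by rewrite mulr_ge0// !addr_ge0// mulr_ge0// ?mulr_ge0 ?(ltW e0)// subr_ge0.
rewrite E1 normrM normfV (gtr0_norm d00) ler_pdivrMr//.
apply: (@le_trans _ _ (m + 2 * C + 15 * C * d0)).
  rewrite (le_trans (ler_normB _ _))// lerD// (le_trans (ler_normB _ _))// lerD//.
have : (m + 2 * C) * 1 <= (m + 2 * C) * d0 by rewrite ler_wpM2l// addr_ge0// mulr_ge0.
lra.
Qed.

Lemma cutoff_bounds : exists C : R, [/\ 0 <= C,
  forall n k, `|dlap delta (cutoff n) k| <= C,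
  forall k : int, `|V k| <= C * (1 + k%:~R ^+ 2),
  forall n k, `|cutoff n k| <= `|V k| &
  forall n k, `|cutoff n k| <= C * n.+1%:R].
Proof.
have [C [C0 hD hV]] := quadratic_growth.
have dd : 0 < delta ^+ 2 by rewrite exprn_gt0.
have M0 : 0 <= M by rewrite (le_trans (ltW (a0 0))).
have E1 : 0 <= M + 17 * C / delta ^+ 2 by rewrite addr_ge0// divr_ge0// ?mulr_ge0// ltW.
exists (M + 17 * C / delta ^+ 2 + C).
have en (n : nat) : 0 < n.+1%:R^-1 :> R by rewrite invr_gt0 ltr0n.
have en1 (n : nat) : n.+1%:R^-1 <= 1 :> R by rewrite invf_le1 ?ler1n ?ltr0n.
have d1 (n : nat) (k : int) : 1 <= 1 + n.+1%:R^-1 * k%:~R ^+ 2 :> R.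
  by rewrite lerDl mulr_ge0 ?sqr_ge0// ltW.
split.
- by rewrite addr_ge0.
- move=> n k; apply: (@le_trans _ _ (M + 17 * C / delta ^+ 2)); last by rewrite lerDl.
  rewrite {1}/dlap normrM normfV (gtr0_norm dd) ler_pdivrMr//.
  have -> : (M + 17 * C / delta ^+ 2) * delta ^+ 2 = delta ^+ 2 * M + 17 * C.
    by field; rewrite gt_eqF.
  rewrite /cutoff !(rmorphD, rmorphB) /= mulr1z.
  apply: cutoff_real_bound => //.
  + by rewrite mulr_ge0// ltW.
  + have -> : V (k + 1) + V (k - 1) - 2 * V k = delta ^+ 2 * a k.
      by rewrite /dlap; field; rewrite gt_eqF.
    by have /andP[h1 h2] := da k; rewrite ger0_norm.
  + by have := hD (k - 1); rewrite subrK rmorphB /= mulr1z.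
  + by have := hV (k + 1); rewrite rmorphD /= mulr1z.
  + by have := hV (k - 1); rewrite rmorphB /= mulr1z.
- move=> k; apply: le_trans (hV k) _; rewrite ler_wpM2r ?lerDr//.
  by rewrite addr_ge0// sqr_ge0.
- move=> n k; have h := d1 n k; have h0 := lt_le_trans ltr01 h.
  by rewrite /cutoff normrM normfV (gtr0_norm h0) ler_pdivrMr// ler_peMr.
- move=> n k; have h := d1 n k; have h0 := lt_le_trans ltr01 h.
  rewrite /cutoff normrM normfV (gtr0_norm h0) ler_pdivrMr//.
  apply: le_trans (hV k) _; rewrite -(mulrA _ n.+1%:R); apply: ler_pM => //.
  + by rewrite addr_ge0// sqr_ge0.
  + by rewrite lerDr.
  + rewrite mulrDr mulr1 mulrA divff ?pnatr_eq0// mul1r lerD2r ler1n//.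
Qed.

Lemma cutoff_cvg k : cutoff n k @[n --> \oo] --> V k.
Proof.
rewrite -[X in _ --> X](@divr1 _ (V k)); apply: cvgM; first exact: cvg_cst.
apply: cvgV; first exact: oner_neq0.
rewrite -[X in _ --> X]addr0; apply: cvgD; first exact: cvg_cst.
rewrite -[X in _ --> X](mul0r (k%:~R ^+ 2 : R)); apply: cvgM; last exact: cvg_cst.
exact: cvg_harmonic.
Qed.

Lemma isum_dlap (phi J : int -> R) (B : R) : (forall k, `|phi k| <= B) -> summableZ J ->
  isum (fun k => phi k * dlap delta J k) = isum (fun k => dlap delta phi k * J k).
Proof.
move=> pB sJ.
have B0 : 0 <= B by exact: le_trans (pB 0).
have sm (p : int -> R) (j : int) : (forall k, `|p k| <= B) ->
    summableZ (fun k => p k * J (k + j)).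
  move=> pb; apply: (@summableZ_le _ _ (fun k => B * J (k + j))).
    by move=> k; rewrite !normrM ler_wpM2r// (le_trans (pb _))// ler_norm.
  exact/summableZZ/summableZ_shift.
have sm0 (p : int -> R) : (forall k, `|p k| <= B) -> summableZ (fun k => p k * J k).
  by move=> pb; have := sm p 0 pb; under eq_fun do rewrite addr0.
have LE : (fun k => phi k * dlap delta J k) = (fun k => (delta ^+ 2)^-1 *
   (phi k * J (k + 1) + phi k * J (k - 1) - 2 * (phi k * J k))).
  by apply/funext => k; rewrite /dlap; field; rewrite gt_eqF.
have RE : (fun k => dlap delta phi k * J k) = (fun k => (delta ^+ 2)^-1 *
   (phi (k + 1) * J k + phi (k - 1) * J k - 2 * (phi k * J k))).
  by apply/funext => k; rewrite /dlap; field; rewrite gt_eqF.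
have s1 := sm phi 1 pB; have s2 := sm phi (-1) pB; have s3 := sm0 phi pB.
have s4 : summableZ (fun k => phi (k + 1) * J k) by apply: (sm0 (fun k => phi (k + 1))).
have s5 : summableZ (fun k => phi (k - 1) * J k) by apply: (sm0 (fun k => phi (k - 1))).
have s6 := summableZZ 2 s3.
have sB (f g : int -> R) : summableZ f -> summableZ g -> summableZ (fun k => f k - g k).
  move=> sf sg; have := summableZD sf (summableZZ (-1) sg).
  by under eq_fun do rewrite mulN1r.
rewrite LE RE !isumZ; last 2 first.
- by apply: sB => //; exact: summableZD.
- by apply: sB => //; exact: summableZD.
rewrite !isumB//; [|exact: summableZD..].
rewrite !isumD//; congr (_ * (_ - _)); rewrite addrC; congr (_ + _).
- rewrite -(isum_shift 1 s2); congr isum; apply/funext => k.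
  by rewrite addrK.
- rewrite -(isum_shift (-1) s1); congr isum; apply/funext => k.
  by rewrite subrK.
Qed.

(** V J need not be summable, so [isum_dlap] is applied to the cutoffs. The limit is dominated on
    the left by the second-moment weight on the Laplacian of J, on the right by |J| times the
    uniform bound on the Laplacians of the cutoffs. *)
Lemma isum_energy (J : int -> R) : summableZ J ->
  summableZ (fun k => (1 + k%:~R ^+ 2) * dlap delta J k) ->
  isum (fun k => V k * dlap delta J k) = isum (fun k => a k * J k).
Proof.
move=> sJ snu; have [C [C0 hL hV hle hb]] := cutoff_bounds.
have k2 (k : int) : 0 <= 1 + k%:~R ^+ 2 :> R by rewrite addr_ge0// sqr_ge0.
apply: (@cvg_unique _ _ (isum (fun k => cutoff n k * dlap delta J k) @[n --> \oo])) => //.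
- apply: (@isum_dominated_cvg _ _ _ (fun k => C * `|(1 + k%:~R ^+ 2) * dlap delta J k|)).
  + by move=> k; apply: cvgM; [exact: cutoff_cvg|exact: cvg_cst].
  + apply: summableZZ; move: snu; apply: summableZ_le => k.
    by rewrite normr_id.
  + move=> n k; rewrite (normrM (cutoff n k)) (normrM (1 + _)) mulrA ler_wpM2r//.
    by rewrite (ger0_norm (k2 k)); exact: le_trans (hV k).
- have -> : (fun n => isum (fun k => cutoff n k * dlap delta J k)) =
     (fun n => isum (fun k => dlap delta (cutoff n) k * J k)).
    by apply/funext => n; exact: isum_dlap (hb n) sJ.
  apply: (@isum_dominated_cvg _ _ _ (fun k => C * `|J k|)).
  + move=> k; apply: cvgM; last exact: cvg_cst.
    apply: cvgM; last exact: cvg_cst.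
    apply: cvgB; first by apply: cvgD; exact: cutoff_cvg.
    by apply: cvgM; [exact: cvg_cst|exact: cutoff_cvg].
  + apply: summableZZ; move: sJ; apply: summableZ_le => k.
    by rewrite normr_id.
  + by move=> n k; rewrite normrM ler_wpM2r.
Qed.

End Growth.

(** * Square-integrable functions *)

Section SquareIntegrable.
Variable R : realType.
Local Notation mu := (@lebesgue_measure R).
Local Notation I := (`[0%R, 1%R]%classic : set R).

(** Densities here are at most 1 / delta, so finite action bounds each momentum coordinate in L^2 of
    time. *)
Lemma sqr_le_Qf (p r C : R) : 0 < C -> 0 <= r -> r <= C -> ((p ^+ 2)%:E <= C%:E * Qf p r)%E.
Proof.
move=> C0; rewrite le_eqVlt /Qf => /predU1P[<- _|r0 rC].
  rewrite ltxx; case: ifPn => [/eqP ->|p0]; first by rewrite mule0 expr0n.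
  by rewrite gt0_muley ?lte_fin// leey.
rewrite r0 -EFinM lee_fin mulrA ler_pdivlMr// mulrC.
by rewrite ler_wpM2r// sqr_ge0.
Qed.

Lemma Qf_sub (p r b : R) : 0 <= r ->
  (Qf (p - b * r) r <= 2%:E * Qf p r + (2 * b ^+ 2 * r)%:E)%E.
Proof.
move=> r0; have h0 : 0 <= 2^-1 * r by rewrite mulr_ge0.
(* Giving half of the density to each summand is what produces the factors 2. *)
have -> : Qf (p - b * r) r = Qf (1 * p + (- b) * r) (2^-1 * r + 2^-1 * r).
  by congr Qf; [ring|field].
apply: le_trans (QfD _ _ h0 h0) _; apply: leeD.
  by rewrite QfZ// expr1n mul1r invrK.
rewrite QfZ//; move: r0; rewrite le_eqVlt /Qf => /predU1P[<-|r0].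
  by rewrite ltxx eqxx mule0 mulr0.
by rewrite r0 -EFinM lee_fin le_eqVlt; apply/orP; left; apply/eqP; field; rewrite gt_eqF.
Qed.

Lemma L2_integrable (g : R -> R) : L2_01 g -> mu.-integrable I (EFin \o g).
Proof.
rewrite /L2_01 /I01 => -[mg g2].
have ig2 : mu.-integrable I (EFin \o (fun s => g s ^+ 2)).
  apply/integrableP; split; first by apply/measurable_EFinP; exact: measurable_funX.
  by under eq_integral do rewrite /= ger0_norm ?sqr_ge0//.
apply: (@le_integrable _ _ R mu I _ _ (EFin \o (fun s => 1 + g s ^+ 2))) => //.
- by apply/measurable_EFinP.
- move=> s _ /=; rewrite lee_fin (ger0_norm (addr_ge0 ler01 (sqr_ge0 _))).
  have : 0 <= (`|g s| - 1) ^+ 2 by exact: sqr_ge0.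
  have -> : g s ^+ 2 = `|g s| ^+ 2 by rewrite real_normK// num_real.
  have := normr_ge0 (g s); nra.
exact: (integrableD _ (integrable_cst_itv true false 0 1 1) ig2).
Qed.

Lemma L2_D (f g : R -> R) : L2_01 f -> L2_01 g -> L2_01 (fun s => f s + g s).
Proof.
rewrite /L2_01 /I01 => -[mf f2] [mg g2]; split; first exact: measurable_funD.
have mf2 : measurable_fun I (fun s => ((f s) ^+ 2)%:E) by apply/measurable_EFinP; exact: measurable_funX.
have mg2 : measurable_fun I (fun s => ((g s) ^+ 2)%:E) by apply/measurable_EFinP; exact: measurable_funX.
apply: (@le_lt_trans _ _ (\int[mu]_(s in I) (2%:E * ((f s ^+ 2)%:E + (g s ^+ 2)%:E)))%E).
  apply: ge0_le_integral => //.
  - by move=> s _; rewrite lee_fin sqr_ge0.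
  - by apply/measurable_EFinP; apply: measurable_funX; exact: measurable_funD.
  - by apply: emeasurable_funM => //; exact: emeasurable_funD.
  - move=> s _; rewrite -EFinD -EFinM lee_fin.
    by have := sqr_ge0 (f s - g s); nra.
rewrite ge0_integralZl//; last 2 first.
- exact: emeasurable_funD.
- by move=> s _; rewrite -EFinD lee_fin addr_ge0 ?sqr_ge0.
rewrite ge0_integralD//; try by move=> s _; rewrite lee_fin sqr_ge0.
by rewrite lte_mul_pinfty// lte_add_pinfty.
Qed.

Lemma L2_Z (c : R) (f : R -> R) : L2_01 f -> L2_01 (fun s => c * f s).
Proof.
rewrite /L2_01 /I01 => -[mf f2]; split; first exact: measurable_funM.
under eq_integral do rewrite exprMn EFinM.
rewrite ge0_integralZl//.
- by rewrite lte_mul_pinfty// lee_fin sqr_ge0.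
- by apply/measurable_EFinP; exact: measurable_funX.
- by move=> s _; rewrite lee_fin sqr_ge0.
- by rewrite lee_fin sqr_ge0.
Qed.

Lemma L2_dlap (delta : R) (w : R -> int -> R) k : (forall j, L2_01 (w ^~ j)) ->
  L2_01 (fun s => dlap delta (w s) k).
Proof.
move=> hw.
have -> : (fun s => dlap delta (w s) k) = (fun s => (delta ^+ 2)^-1 *
   (w s (k + 1) + w s (k - 1) + (- 2) * w s k)).
  by apply/funext => s; rewrite /dlap mulrC mulNr.
by apply: L2_Z; apply: L2_D; [exact: L2_D|exact: L2_Z].
Qed.

Lemma ac_of_H1 (f g g' : R -> R) : H1_01_deriv f g ->
  {ae mu, forall s, @I01 R s -> g s = g' s} -> measurable_fun I g' -> ac f g'.
Proof.
move=> [g2 fg] ae mg'.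
have ig := L2_integrable g2; have [mg _] := g2.
have aeE : ae_eq mu I (EFin \o g) (EFin \o g').
  exact: (ae_eq_comp EFin ae).
have mEg : measurable_fun I (EFin \o g) by exact/measurable_EFinP.
have mEg' : measurable_fun I (EFin \o g') by exact/measurable_EFinP.
split.
  apply/integrableP; split => //; move/integrableP : ig => [_].
  suff -> : (\int[mu]_(x in I) `|(EFin \o g) x| = \int[mu]_(x in I) `|(EFin \o g') x|)%E by [].
  apply: ae_eq_integral => //.
  - by apply: (measurableT_comp _ mEg).
  - by apply: (measurableT_comp _ mEg').
  - exact: ae_eq_abse.
move=> t tI; rewrite fg//; congr (_ + _); rewrite /Rintegral; congr fine.
have sub : `[0, t] `<=` `[0%R, 1%R]%classic by apply: subset_itv; rewrite bnd_simp//; case/andP: tI.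
apply: ae_eq_integral => //; try exact: measurable_funS sub _.
exact: ae_eq_subset aeE.
Qed.

End SquareIntegrable.

(** * Energy along curves *)

Section CurveEnergy.
Variables (R : realType) (delta : R) (V : int -> R) (M : R).
Hypothesis delta0 : 0 < delta.
Local Notation mu := (@lebesgue_measure R).
Local Notation I := (`[0%R, 1%R]%classic : set R).
Local Notation a := (dlap delta V).
Hypothesis a0 : forall k, 0 < a k.
Hypothesis aM : forall k, a k <= M.

Let M0 : 0 < M. Proof. exact: lt_le_trans (a0 0) (aM 0). Qed.
Let I0 : I 0. Proof. by rewrite /= in_itv /= lexx ler01. Qed.
Let I1 : I 1. Proof. by rewrite /= in_itv /= lexx ler01. Qed.

Lemma P2c_moment (r : int -> R) : P2c delta r ->
  summableZ (fun k => (1 + k%:~R ^+ 2) * r k).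
Proof.
move=> hr; have [r0 [_ [m2 _]]] := hr.
have s1 : summableZ r.
  rewrite /summableZ; under eq_esum do rewrite ger0_norm//.
  by rewrite (P2c_mass delta0 hr) ltry.
have k0 (k : int) : 0 <= delta * (delta * k%:~R) ^+ 2 * r k.
  by rewrite mulr_ge0// mulr_ge0 ?sqr_ge0// ltW.
have s2 : summableZ (fun k => delta * (delta * k%:~R) ^+ 2 * r k).
  rewrite /summableZ; under eq_esum do rewrite ger0_norm//.
  by rewrite -zsum_ge0.
have := summableZD s1 (summableZZ (delta ^- 3) s2); congr summableZ.
by apply/funext => k; field; rewrite gt_eqF.
Qed.

Lemma P2c_summable_V (r : int -> R) : P2c delta r -> summableZ (fun k => V k * r k).
Proof.
move=> hr; have [C [C0 _ hV]] := quadratic_growth delta0 a0 aM.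
apply: summableZ_le (summableZZ C (P2c_moment hr)) => k.
rewrite mulrA normrM normrM ler_wpM2r//.
by rewrite (le_trans (hV k))// ler_norm.
Qed.

Definition ener (r : int -> R) : R := - (delta * isum (fun k => V k * r k)).

Lemma energyE (r : int -> R) : P2c delta r -> energy delta V r = (ener r)%:E.
Proof.
move=> hr; have sV := P2c_summable_V hr; rewrite /energy /ener.
have -> : (fun k => delta * V k * r k) = (fun k => delta * (V k * r k)).
  by apply/funext => k; rewrite mulrA.
by rewrite zsum_isum ?isumZ//; exact: summableZZ.
Qed.

(** Finite second moments of both endpoints yield the weighted summability required by
    [isum_energy]. J will be the time integral of the momentum. *)
Lemma ener_diff (r0 r1 J : int -> R) : P2c delta r0 -> P2c delta r1 -> summableZ J ->
  (forall k, r1 k - r0 k = dlap delta J k) ->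
  ener r1 - ener r0 = - (delta * isum (fun k => a k * J k)).
Proof.
move=> h0 h1 sJ E.
rewrite -(isum_energy delta0 a0 aM)//; last first.
  have := summableZD (P2c_moment h1) (summableZZ (-1) (P2c_moment h0)).
  by congr summableZ; apply/funext => k; rewrite -E; ring.
have -> : (fun k => V k * dlap delta J k) = (fun k => V k * r1 k - V k * r0 k).
  by apply/funext => k; rewrite -E mulrBr.
by rewrite isumB ?P2c_summable_V// /ener; ring.
Qed.

Lemma Rintegral_dlap (w : R -> int -> R) k :
  (forall j, mu.-integrable I (EFin \o (w ^~ j))) ->
  \int[mu]_(s in I) dlap delta (w s) k = dlap delta (fun j => \int[mu]_(s in I) w s j) k.
Proof.
move=> iw.
have i2 : mu.-integrable I (EFin \o (fun s => 2 * w s k)) by exact: (integrableZl _ 2 (iw k)).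
have i1 : mu.-integrable I (EFin \o (fun s => w s (k + 1) + w s (k - 1))).
  exact: (integrableD _ (iw (k + 1)) (iw (k - 1))).
rewrite /dlap RintegralZr//; last exact: (integrableB _ i1 i2).
rewrite RintegralB//.
by rewrite RintegralD// RintegralZl.
Qed.

Lemma curve_momentum (w : R -> int -> R) (H : R -> \bar R) :
  (forall k, measurable_fun I (w ^~ k)) -> measurable_fun I H ->
  (forall s, I s -> \esum_(k in [set: int]) `|w s k|%:E <= H s)%E ->
  (\int[mu]_(s in I) H s < +oo)%E ->
  [/\ forall k, mu.-integrable I (EFin \o (w ^~ k)),
      summableZ (fun k => \int[mu]_(s in I) w s k) &
      (\esum_(k in [set: int]) `|\int[mu]_(s in I) w s k|%:E <= \int[mu]_(s in I) H s)%E].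
Proof.
move=> mw mH wH Hf.
have mabs k : measurable_fun I (fun s => `|w s k|%:E).
  by apply/measurable_EFinP; exact: measurableT_comp.
have tot : (\esum_(k in [set: int]) (\int[mu]_(s in I) `|w s k|%:E) <= \int[mu]_(s in I) H s)%E.
  rewrite -integral_esum//; apply: ge0_le_integral => //.
  - by move=> s _; apply: esum_ge0.
  - exact: measurable_esum.
have iw k : mu.-integrable I (EFin \o (w ^~ k)).
  apply/integrableP; split; first by apply/measurable_EFinP; exact: mw.
  apply: le_lt_trans Hf; apply: le_trans tot.
  apply: (@le_term_esum R (fun k => \int[mu]_(s in I) `|w s k|%:E)%E) => j.
  exact: integral_ge0.
have lej : (\esum_(k in [set: int]) `|\int[mu]_(s in I) w s k|%:E <= \int[mu]_(s in I) H s)%E.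
  apply: le_trans tot; apply: le_esum => k _.
  rewrite (le_trans (_ : _ <= (\int[mu]_(s in I) `|w s k|)%:E)%E)//.
    by rewrite lee_fin; apply: le_normr_Rintegral => //; exact: iw.
  rewrite /Rintegral fineK//.
  exact: (integrable_fin_num _ (integrable_abse (iw k))).
by split => //; exact: le_lt_trans Hf.
Qed.

Lemma ac_momentum (rho w : R -> int -> R) k :
  (forall k, ac (rho ^~ k) (fun s => dlap delta (w s) k)) ->
  (forall j, mu.-integrable I (EFin \o (w ^~ j))) ->
  rho 1 k - rho 0 k = dlap delta (fun j => \int[mu]_(s in I) w s j) k.
Proof.
move=> hac iw; have [_ h] := hac k.
by rewrite (h 1) ?ler01 ?lexx// addrC addrA addNr add0r Rintegral_dlap.
Qed.

(** The rescaled flow has the nonnegative momentum t a rho, whose time integral J sums to at most t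
    M / delta. By [ener_diff] the energy changes by -delta times the sum of a J, at least -M^2 t. *)
Lemma ener_semigroup (S : R -> (int -> R) -> (int -> R)) (r : int -> R) (t : R) :
  generated_semigroup delta V S -> P2c delta r -> 0 < t ->
  ener r - M ^+ 2 * t <= ener (S t r).
Proof.
move=> genS hr t0.
have [S0 [SP _]] := genS _ hr.
have SI s : I s -> P2c delta (S (t * s) r).
  by rewrite /= in_itv /= => /andP[s0 _]; apply: SP; rewrite mulr_ge0// ltW.
pose rho s := S (t * s) r; pose w s j := t * (a j * rho s j).
have hac k : ac (rho ^~ k) (fun s => dlap delta (w s) k) by exact: (semigroup_ac delta0 genS).
have w0 s k : I s -> 0 <= w s k.
  move=> Is; rewrite /w mulr_ge0 ?(ltW t0)// mulr_ge0 ?(ltW (a0 _))//.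
  exact: P2c_ge0 (SI s Is).
have mw k : measurable_fun I (w ^~ k).
  apply: measurable_funM => //; apply: measurable_funM => //; exact: ac_measurable (hac k).
have c0 : 0 <= t * M / delta by rewrite divr_ge0 ?(ltW delta0)// mulr_ge0// ltW.
have Hint : (\int[mu]_(s in I) cst (t * M / delta)%:E s = (t * M / delta)%:E)%E.
  rewrite integral_cst//; have := @lebesgue_measure_itv R `[0, 1]; rewrite /= lte_fin ltr01 => ->.
  by rewrite oppr0 adde0 mule1.
have wH s : I s -> (\esum_(k in [set: int]) `|w s k|%:E <= cst (t * M / delta)%:E s)%E.
  move=> Is; apply: (@le_trans _ _ (\esum_(k in [set: int]) ((t * M)%:E * (rho s k)%:E)%E)).
    apply: le_esum => k _; rewrite ger0_norm ?w0// -EFinM lee_fin /w -(mulrA t M) ler_wpM2l ?(ltW t0)//.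
    by rewrite ler_wpM2r//; exact: P2c_ge0 (SI s Is).
  rewrite esumZl ?mulr_ge0 ?(ltW t0) ?(ltW M0)//; last first.
    by move=> k; rewrite lee_fin; exact: P2c_ge0 (SI s Is).
  by rewrite (P2c_mass delta0 (SI s Is)) -EFinM.
have Hf : (\int[mu]_(s in I) cst (t * M / delta)%:E s < +oo)%E by rewrite Hint ltry.
have [iw sJ leJ] := curve_momentum mw (@measurable_cst _ _ _ _ _ _) wH Hf.
set J := (fun k => \int[mu]_(s in I) w s k) in sJ leJ.
have sJ' : summableZ (fun k => `|J k|) by apply: summableZ_le sJ => k; rewrite normr_id.
have E k : S t r k - r k = dlap delta J k.
  by have := ac_momentum k hac iw; rewrite /rho mulr1 mulr0 S0.
have := ener_diff hr (SP t (ltW t0)) sJ E.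
have : isum (fun k => a k * J k) <= M * (t * M / delta).
  apply: (@le_trans _ _ (M * isum (fun k => `|J k|))).
    rewrite -isumZ//; apply: le_isum; last 2 first.
    - exact: summableZZ.
    - by move=> k; rewrite (le_trans (ler_norm _))// normrM ler_wpM2r// gtr0_norm.
    apply: summableZ_le (summableZZ M sJ') => k.
    by rewrite (normrM (a k)) (normrM M) normr_id ler_wpM2r// (gtr0_norm (a0 k)) (gtr0_norm M0).
  rewrite ler_wpM2l ?(ltW M0)// -lee_fin isum_ge0E//.
  by rewrite -Hint.
rewrite -(ler_pM2l delta0) => h1 h2.
have e : delta * (M * (t * M / delta)) = M ^+ 2 * t by field; rewrite gt_eqF.
move: h1; rewrite e => h1.
by move: h1 h2; lra.
Qed.

Lemma action_lty (rho w : R -> int -> R) : (action delta rho w < +oo)%E <->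
  (\esum_(k in [set: int]) (\int[mu]_(s in I) Qf (w s k) (rho s k))%E < +oo)%E.
Proof.
rewrite /action /I01; set s := \esum_(k in _) _.
have : (0 <= s)%E by apply: esum_ge0 => k _; apply: integral_ge0 => x _; exact: Qf_ge0.
case: s => [s| |] //= _; first by rewrite -EFinM !ltry.
by rewrite gt0_muley// lte_fin.
Qed.

(** [Qf_shift] with b = t a: the term t^2 a^2 rho is dropped, and the cross term integrates to an
    energy difference by [ener_diff]. Finiteness of the action of w is established beforehand
    through [Qf_sub], as it makes w integrable and the rearrangement legitimate. *)
Lemma action_by_parts (t : R) (rho w : R -> int -> R) : 0 <= t ->
  (forall s, I s -> P2c delta (rho s)) ->
  (forall k, ac (rho ^~ k) (fun s => dlap delta (w s) k)) ->
  (forall k, measurable_fun I (w ^~ k)) ->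
  (action delta rho (fun s k => w s k + t * a k * rho s k)%R < +oo)%E ->
  (action delta rho w < +oo)%E /\
  (action delta rho w <= action delta rho (fun s k => w s k + t * a k * rho s k)%R +
    (2 * t * (ener (rho 1%R) - ener (rho 0%R)))%:E)%E.
Proof.
move=> t0 hP hac mw /(action_lty _ _).1; rewrite action_lty /action /I01 => Uf.
have mr k : measurable_fun I (rho ^~ k) by exact: ac_measurable (hac k).
have r0 s k : I s -> 0 <= rho s k by move=> Is; exact: P2c_ge0 (hP s Is).
pose U s k := w s k + t * a k * rho s k.
have mU k : measurable_fun I (U ^~ k).
  by apply: measurable_funD => //; apply: measurable_funM.
have mQw k : measurable_fun I (fun s => Qf (w s k) (rho s k)) by exact: measurable_Qf.
have mQU k : measurable_fun I (fun s => Qf (U s k) (rho s k)) by exact: measurable_Qf.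
have Qw0 k s : (0 <= Qf (w s k) (rho s k))%E by exact: Qf_ge0.
have QU0 k s : (0 <= Qf (U s k) (rho s k))%E by exact: Qf_ge0.
pose FU s := \esum_(k in [set: int]) Qf (U s k) (rho s k).
pose Fw s := \esum_(k in [set: int]) Qf (w s k) (rho s k).
have mFU : measurable_fun I FU by exact: measurable_esum.
have mFw : measurable_fun I Fw by exact: measurable_esum.
have FU0 s : (0 <= FU s)%E by apply: esum_ge0 => k _; exact: QU0.
have Fw0 s : (0 <= Fw s)%E by apply: esum_ge0 => k _; exact: Qw0.
have cI (c : R) : (\int[mu]_(s in I) cst c%:E s = c%:E)%E.
  rewrite integral_cst//; have := @lebesgue_measure_itv R `[0, 1]; rewrite /= lte_fin ltr01 => ->.
  by rewrite oppr0 adde0 mule1.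
pose c1 := 2 * (t * M) ^+ 2 / delta.
have c10 : 0 <= c1 by rewrite divr_ge0 ?(ltW delta0)// mulr_ge0// sqr_ge0.
have c20 : 0 <= 2 * (t * M) ^+ 2 by rewrite mulr_ge0// sqr_ge0.
have FwU s : I s -> (Fw s <= 2%:E * FU s + c1%:E)%E.
  move=> Is; apply: (@le_trans _ _ (\esum_(k in [set: int])
      (2%:E * Qf (U s k) (rho s k) + (2 * (t * M) ^+ 2)%:E * (rho s k)%:E)%E)).
    apply: le_esum => k _.
    have -> : w s k = U s k - (t * a k) * rho s k by rewrite /U addrK.
    apply: le_trans (Qf_sub _ _ (r0 s k Is)) _; rewrite leeD2l// -EFinM lee_fin.
    have h1 := mulr_ge0 t0 (ltW (a0 k)); have h2 := mulr_ge0 t0 (ltW M0).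
    by rewrite ler_wpM2r ?r0// ler_wpM2l// ler_pXn2r ?nnegrE// ler_wpM2l.
  rewrite esumD; last 2 first.
  - by move=> k _; rewrite mule_ge0.
  - by move=> k _; apply: mule_ge0; rewrite lee_fin ?r0.
  rewrite !esumZl//; last by move=> k; rewrite lee_fin r0.
  by rewrite (P2c_mass delta0 (hP s Is)) -EFinM.
have IFU : (\int[mu]_(s in I) FU s < +oo)%E by rewrite integral_esum.
have IFw : (\int[mu]_(s in I) Fw s < +oo)%E.
  apply: (@le_lt_trans _ _ (\int[mu]_(s in I) (2%:E * FU s + cst c1%:E s))%E).
    apply: ge0_le_integral => //.
    by apply: emeasurable_funD => //; exact: emeasurable_funM.
  rewrite ge0_integralD//; last 2 first.
  - by move=> s _; rewrite mule_ge0.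
  - exact: emeasurable_funM.
  - by rewrite ge0_integralZl// cI lte_add_pinfty ?ltry// lte_mul_pinfty.
have Ww : (\esum_(k in [set: int]) (\int[mu]_(s in I) Qf (w s k) (rho s k)) < +oo)%E.
  by rewrite -integral_esum.
split => //.
pose H s := (Fw s + cst (delta^-1)%:E s)%E.
have wH s : I s -> (\esum_(k in [set: int]) `|w s k|%:E <= H s)%E.
  move=> Is; rewrite /H /= -(P2c_mass delta0 (hP s Is)) -esumD//; last first.
    by move=> k _; rewrite lee_fin r0.
  by apply: le_esum => k _; apply: normr_le_Qf; exact: r0.
have mH : measurable_fun I H by exact: emeasurable_funD.
have IH : (\int[mu]_(s in I) H s < +oo)%E.
  rewrite ge0_integralD//; first by rewrite cI lte_add_pinfty ?ltry.
  by move=> s _; rewrite lee_fin invr_ge0 ltW.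
have [iw sJ leJ] := curve_momentum mw mH wH IH.
set J := (fun k => \int[mu]_(s in I) w s k) in sJ leJ.
have E k : rho 1 k - rho 0 k = dlap delta J k by exact: ac_momentum.
have dE := ener_diff (hP 0 I0) (hP 1 I1) sJ E.
pose qw k := (\int[mu]_(s in I) Qf (w s k) (rho s k))%E.
pose qU k := (\int[mu]_(s in I) Qf (U s k) (rho s k))%E.
have qw0 k : (0 <= qw k)%E by exact: integral_ge0.
have qU0 k : (0 <= qU k)%E by exact: integral_ge0.
have fqw k : qw k \is a fin_num.
  by rewrite ge0_fin_numE//; apply: le_lt_trans Ww; exact: (@le_term_esum R qw).
have fqU k : qU k \is a fin_num.
  by rewrite ge0_fin_numE//; apply: le_lt_trans Uf; exact: (@le_term_esum R qU).
have sw : summableZ (fine \o qw).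
  rewrite /summableZ; under eq_esum => k _ do rewrite /= ger0_norm ?fine_ge0// fineK//.
  by [].
have sU : summableZ (fine \o qU).
  rewrite /summableZ; under eq_esum => k _ do rewrite /= ger0_norm ?fine_ge0// fineK//.
  by [].
have saJ : summableZ (fun k => a k * J k).
  apply: summableZ_le (summableZZ M sJ) => k.
  by rewrite (normrM (a k)) (normrM M) ler_wpM2r// (gtr0_norm (a0 k)) (gtr0_norm M0).
have key k : fine (qw k) + 2 * t * (a k * J k) <= fine (qU k).
  have iQ : mu.-integrable I (fun s => Qf (w s k) (rho s k)).
    apply/integrableP; split; first exact: mQw.
    under eq_integral do rewrite gee0_abs//.
    by move: (fqw k); rewrite ge0_fin_numE.
  have iJ : mu.-integrable I (EFin \o (fun s => 2 * t * a k * w s k)).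
    exact: (integrableZl _ (2 * t * a k) (iw k)).
  have eJ : ((2 * t * (a k * J k))%:E = \int[mu]_(s in I) (2 * t * a k * w s k)%:E)%E.
    rewrite (_ : 2 * t * (a k * J k) = \int[mu]_(s in I) (2 * t * a k * w s k)).
      by rewrite /Rintegral fineK//; exact: (integrable_fin_num _ iJ).
    by rewrite RintegralZl// /J mulrA.
  rewrite -lee_fin EFinD eJ fineK// fineK// -integralD//.
  apply: le_integral => //; first exact: (integrableD _ iQ iJ).
    apply/integrableP; split; first exact: mQU.
    under eq_integral do rewrite gee0_abs//.
    by move: (fqU k); rewrite ge0_fin_numE.
  move=> s; rewrite inE => Is.
  rewrite (@Qf_shift _ (U s k) _ (t * a k) (r0 s k Is)) /U addrK leeD2l// lee_fin.
  by rewrite (mulrA 2 t) lerDl mulr_ge0 ?sqr_ge0// r0.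
have tot : isum (fine \o qw) + 2 * t * isum (fun k => a k * J k) <= isum (fine \o qU).
  rewrite -isumZ// -isumD//; last exact: summableZZ.
  apply: le_isum => //; apply: summableZD => //; exact: summableZZ.
have Ew : \esum_(k in [set: int]) qw k = (isum (fine \o qw))%:E.
  by rewrite isum_ge0E//= => [|k]; [apply: eq_esum => k _; rewrite fineK|rewrite fine_ge0].
have EU : \esum_(k in [set: int]) qU k = (isum (fine \o qU))%:E.
  by rewrite isum_ge0E//= => [|k]; [apply: eq_esum => k _; rewrite fineK|rewrite fine_ge0].
rewrite -/(qw _) Ew EU -!EFinM -EFinD lee_fin dE.
have := ler_wpM2l (ltW delta0) tot; lra.
Qed.

End CurveEnergy.

(** * Contraction estimate *)

Section Contraction.
Variables (R : realType) (delta : R) (V : int -> R) (M Lam : R).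
Variable S : R -> (int -> R) -> (int -> R).
Hypothesis delta0 : 0 < delta.
Local Notation mu := (@lebesgue_measure R).
Local Notation I := (`[0%R, 1%R]%classic : set R).
Local Notation a := (dlap delta V).
Hypothesis a0 : forall k, 0 < a k.
Hypothesis aM : forall k, a k <= M.
Hypothesis Lam0 : 0 <= Lam.
Hypothesis aLam : forall k, dlap delta (fun j => a j ^+ 2) k <= Lam * a k.
Hypothesis genS : generated_semigroup delta V S.
Local Notation q := (qcoef delta V M).
Local Notation c := (rate delta M).
Local Notation P := (Pop q).
Local Notation T := (Top q).

Let M0 : 0 < M. Proof. exact: lt_le_trans (a0 0) (aM 0). Qed.
Let q0 : forall k, 0 < q k. Proof. exact: qcoef_gt0. Qed.
Let q4 : forall k, q k <= 4^-1. Proof. exact: qcoef_le. Qed.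
Let c0 : 0 < c. Proof. by rewrite divr_gt0 ?exprn_gt0// mulr_gt0. Qed.

(** The growth per step is 1 + Lambda h with h = 1 / c; the c steps per unit of time accumulate to
    the rate Lambda. *)
Lemma qcoef_kap k : q (k + 1) ^+ 2 + q (k - 1) ^+ 2 - 2 * q k ^+ 2 <= Lam / c * q k.
Proof.
have m0 : M != 0 by rewrite gt_eqF.
have d0 : delta != 0 by rewrite gt_eqF.
have := aLam k; rewrite /qcoef /rate {1}/dlap.
move: (a k) (a (k + 1)) (a (k - 1)) => x y z h.
have -> : (y / (4 * M)) ^+ 2 + (z / (4 * M)) ^+ 2 - 2 * (x / (4 * M)) ^+ 2 =
  (delta / (4 * M)) ^+ 2 * ((y ^+ 2 + z ^+ 2 - 2 * x ^+ 2) / delta ^+ 2).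
  by field; rewrite m0 d0.
have -> : Lam / (4 * M / delta ^+ 2) * (x / (4 * M)) =
  (delta / (4 * M)) ^+ 2 * (Lam * x) by field; rewrite m0 d0.
by rewrite ler_wpM2l// sqr_ge0.
Qed.

Lemma ell2_bounded (u : int -> R) : ell2 u -> exists B, forall k, `|u k| <= B.
Proof.
move=> u2; pose s := \esum_(k in [set: int]) (u k ^+ 2)%:E.
have s0 : (0 <= s)%E by apply: esum_ge0 => k _; rewrite lee_fin sqr_ge0.
have sf : s \is a fin_num by rewrite ge0_fin_numE.
exists (1 + fine s) => k.
have : u k ^+ 2 <= fine s.
  rewrite -lee_fin fineK//; apply: (@le_term_esum R (fun k => (u k ^+ 2)%:E)) => j.
  by rewrite lee_fin sqr_ge0.
have -> : u k ^+ 2 = `|u k| ^+ 2 by rewrite real_normK// num_real.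
by have := sqr_ge0 (`|u k| - 1); have := normr_ge0 (u k); nra.
Qed.

Lemma measurable_iter_Top (w : R -> int -> R) n k : (forall j, measurable_fun I (w ^~ j)) ->
  measurable_fun I (fun s => iter n T (w s) k).
Proof.
move=> mw; elim: n k => [|n IH] k //=.
apply: measurable_funD; first exact: measurable_funM.
by apply: measurable_funM => //; exact: measurable_funD.
Qed.

Lemma transport_curve (rb eb : int -> R) (rho w : R -> int -> R) (t : R) : 0 < t ->
  P2c delta rb -> P2c delta eb -> admissible delta rb eb rho w ->
  (action delta rho w < +oo)%E ->
  (Dsq delta (S t rb) eb <= (expR (Lam * t))%:E * action delta rho w +
     (2 * t * (ener delta V eb - ener delta V (S t rb)))%:E)%E.
Proof.
move=> t0 hrb heb [hP [hell [rho0 [rho1 hk]]]] Af.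
have Ispec s : I s -> 0 <= s <= 1 by rewrite /= in_itv.
have hPI s : I s -> P2c delta (rho s) by move=> /Ispec; exact: hP.
have r0 s k : I s -> 0 <= rho s k by move=> Is; exact: P2c_ge0 (hPI s Is).
have mw k : measurable_fun I (w ^~ k) by have [[]] := hk k.
have hac k : ac (rho ^~ k) (fun s => dlap delta (w s) k).
  have [_ [g [hg ae]]] := hk k; apply: ac_of_H1 hg ae _.
  have [] // := @L2_dlap R delta w k _ => j; by have [] := hk j.
have mr k : measurable_fun I (rho ^~ k) by exact: ac_measurable (hac k).
have rB s k : I s -> `|rho s k| <= delta^-1 by move=> Is; exact/P2c_le/hPI.
have wb s : I s -> exists C, forall k, `|w s k| <= C.
  by move=> /Ispec /hell; exact: ell2_bounded.
have mQ k : measurable_fun I (fun s => Qf (w s k) (rho s k)) by exact: measurable_Qf.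
pose F s := \esum_(k in [set: int]) Qf (w s k) (rho s k).
have mF : measurable_fun I F by apply: measurable_esum => // k s; exact: Qf_ge0.
have F0 s : (0 <= F s)%E by apply: esum_ge0 => k _; exact: Qf_ge0.
have IF : (\int[mu]_(s in I) F s < +oo)%E.
  by rewrite integral_esum//; [exact/(action_lty delta0)|move=> k s; exact: Qf_ge0].
(* Membership in l^2 at each time gives no bound integrable in s; this majorant comes from |w| <= Q
   + rho and rho <= 1 / delta. *)
pose G s := (F s + cst (delta^-1)%:E s)%E.
have iF : mu.-integrable I F.
  apply/integrableP; split; first exact: mF.
  by under eq_integral do rewrite gee0_abs//.
have iG : mu.-integrable I G.
  exact: (integrableD _ iF (integrable_cst_itv true false 0 1 delta^-1)).
have wG s k : I s -> (`|w s k|%:E <= G s)%E.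
  move=> Is; apply: le_trans (normr_le_Qf _ (r0 s k Is)) _.
  apply: leeD; first by apply: (@le_term_esum R (fun k => Qf (w s k) (rho s k))) => j; exact: Qf_ge0.
  by rewrite lee_fin (le_trans (ler_norm _))// rB.
pose x s := c * t * (1 - s).
have x0 s : I s -> 0 <= x s.
  by move=> /Ispec /andP[_ s1]; rewrite /x mulr_ge0 ?subr_ge0// mulr_ge0// ltW.
pose U s k := psum (x s) (fun n => iter n T (w s) k).
pose rho' s := S (t * (1 - s)) (rho s).
pose w' s k := U s k - t * (a k * rho' s k).
have rho'E s k : I s -> rho' s k = psum (x s) (fun n => iter n P (rho s) k).
  move=> Is; have /andP[_ s1] := Ispec s Is.
  rewrite /rho' (semigroup_psum delta0 a0 aM genS)//; first by rewrite /x mulrA.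
    exact: hPI.
  by rewrite mulr_ge0 ?subr_ge0// ltW.
have hP' s : 0 <= s <= 1 -> P2c delta (rho' s).
  move=> sI; have /andP[_ s1] := sI; have [_ [+ _]] := genS (hP s sI).
  by apply; rewrite mulr_ge0 ?subr_ge0// ltW.
have hPI' s : I s -> P2c delta (rho' s) by move=> /Ispec; exact: hP'.
have r0' s k : I s -> 0 <= rho' s k by move=> Is; exact: P2c_ge0 (hPI' s Is).
have rB' s k : I s -> rho' s k <= delta^-1.
  by move=> Is; apply: le_trans (ler_norm _) _; exact/P2c_le/hPI'.
have hac' k : ac (rho' ^~ k) (fun s => dlap delta (w' s) k).
  have := ac_flow delta0 a0 aM (ltW t0) hac rB wb iG wG k.
  apply: ac_eq => s Is; first by rewrite rho'E.
  by congr dlap; apply/funext => j; rewrite /w' rho'E.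
have mr' k : measurable_fun I (rho' ^~ k) by exact: ac_measurable (hac' k).
have mU k : measurable_fun I (U ^~ k).
  apply: (@measurable_fun_cvg _ _ _ _
    (fun N s => series (fun n => pois (x s) n * iter n T (w s) k) N)).
    move=> N; apply: measurable_sum => n; apply: measurable_funM.
      exact: ac_measurable (ac_pois (c * t) n).
    exact: measurable_iter_Top.
  move=> s Is; have [C hC] := wb s Is; apply: psum_cvg.
  exact: (expn_bounded_Top q0 q4 _ hC).
have mw' k : measurable_fun I (w' ^~ k).
  by apply: measurable_funB => //; apply: measurable_funM => //; exact: measurable_funM.
(* [U] is the shifted momentum of [action_by_parts], and the one whose action the contraction
   estimate controls. *)
have UE : (fun s k => w' s k + t * a k * rho' s k) = U.
  by apply/funext => s; apply/funext => k; rewrite /w' -mulrA subrK.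
have FU s : I s -> (\esum_(k in [set: int]) Qf (U s k) (rho' s k) <= (expR (Lam * t))%:E * F s)%E.
  move=> Is; have [C hC] := wb s Is; have /andP[s0 s1] := Ispec s Is.
  have C0 : 0 <= C by exact: le_trans (hC 0).
  have kap0 : 0 <= Lam / c by rewrite divr_ge0// ltW.
  have hC' k : `|w s k| <= C + delta^-1 by rewrite (le_trans (hC k))// lerDl invr_ge0 ltW.
  have hr' k : `|rho s k| <= C + delta^-1 by rewrite (le_trans (rB s k Is))// lerDr.
  have := esum_Qf_psum q0 q4 kap0 qcoef_kap (x0 s Is) (fun k => r0 s k Is) hC' hr'.
  move=> h; apply: (@le_trans _ _ ((expR (x s * (Lam / c)))%:E * F s)%E).
    apply: le_trans h; apply: le_esum => k _; by rewrite rho'E.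
  (* The rate cancels in the exponent; Lambda >= 0 and 1 - s <= 1 remove the dependence on s. *)
  rewrite lee_wpmul2r// lee_fin ler_expR (_ : x s * (Lam / c) = Lam * t * (1 - s)).
    by rewrite ler_piMr ?mulr_ge0 ?(ltW t0)// lerBlDr lerDl.
  by rewrite /x; field; rewrite gt_eqF.
have mQU k : measurable_fun I (fun s => Qf (U s k) (rho' s k)) by exact: measurable_Qf.
have AU : (action delta rho' U <= (expR (Lam * t))%:E * action delta rho w)%E.
  rewrite /action /I01 -!integral_esum//; [|by move=> k s; exact: Qf_ge0..].
  rewrite muleCA lee_wpmul2l ?lee_fin ?(ltW delta0)// -ge0_integralZl ?lee_fin ?expR_ge0//;
    last by move=> s _; exact: (F0 s).
  apply: ge0_le_integral => //.
  - by move=> s _; apply: esum_ge0 => k _; exact: Qf_ge0.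
  - by apply: measurable_esum => // k s; exact: Qf_ge0.
  - exact: emeasurable_funM.
have AUf : (action delta rho' U < +oo)%E.
  by apply: le_lt_trans AU _; rewrite lte_mul_pinfty ?lee_fin ?expR_ge0.
have := @action_by_parts R delta V M delta0 a0 aM t rho' w' (ltW t0) hPI' hac' mw'.
rewrite UE => /(_ AUf) [Awf Aw].
have rho'0 : rho' 0 = S t rb by rewrite /rho' subr0 mulr1 rho0.
have rho'1 : rho' 1 = eb by rewrite /rho' subrr mulr0 rho1; have [] := genS heb.
apply: (@le_trans _ _ (action delta rho' w')); last first.
  apply: le_trans Aw _; rewrite rho'0 rho'1.
  exact: leeD2r.
apply: ereal_inf_lbound; exists rho', w'; split => //.
have mQw' k : measurable_fun I (fun s => Qf (w' s k) (rho' s k)) by exact: measurable_Qf.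
have w'L2 k : L2_01 (w' ^~ k).
  rewrite /L2_01 /I01; split; first exact: mw'.
  apply: (@le_lt_trans _ _ (\int[mu]_(s in I) ((delta^-1)%:E * Qf (w' s k) (rho' s k)))%E).
    apply: ge0_le_integral => //.
    - by move=> s _; rewrite lee_fin sqr_ge0.
    - by apply/measurable_EFinP; apply: measurable_funX; exact: mw'.
    - by apply: emeasurable_funM => //; exact: mQw'.
    - move=> s Is; apply: sqr_le_Qf; rewrite ?invr_gt0//; [exact: r0'|exact: rB'].
  rewrite ge0_integralZl//; last 3 first.
  - exact: mQw'.
  - by move=> s _; exact: Qf_ge0.
  - by rewrite lee_fin invr_ge0 ltW.
  rewrite lte_mul_pinfty ?lee_fin ?invr_ge0 ?(ltW delta0)//.
  move/(action_lty delta0) : Awf; apply: le_lt_trans.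
  apply: (@le_term_esum R (fun k => \int[mu]_(s in I) Qf (w' s k) (rho' s k))%E) => j.
  by apply: integral_ge0 => s _; exact: Qf_ge0.
split; [exact: hP'|split; [|split => //; split => //]].
- move=> s sI; have Is : I s by rewrite /= in_itv.
  have [C hC] := wb s Is.
  have := esum_sqr_psum q0 q4 (x0 s Is) hC => hU.
  have Uf : (\esum_(k in [set: int]) (U s k ^+ 2)%:E < +oo)%E.
    apply: le_lt_trans hU _; rewrite lte_mul_pinfty ?lee_fin ?expR_ge0//.
    exact: hell.
  have tM0 : 0 <= t * M by rewrite mulr_ge0// ltW.
  have C20 : 0 <= 2 * ((t * M) ^+ 2 / delta).
    by rewrite mulr_ge0// divr_ge0 ?sqr_ge0// ltW.
  (* Bounds (u - v)^2 by 2 u^2 + 2 v^2: the first part is summable by [esum_sqr_psum], the second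
     since a <= M and rho'^2 <= rho' / delta. *)
  rewrite /ell2; apply: (@le_lt_trans _ _ (\esum_(k in [set: int])
      (2%:E * (U s k ^+ 2)%:E + (2 * ((t * M) ^+ 2 / delta))%:E * (rho' s k)%:E)%E)).
    apply: le_esum => k _; rewrite -!EFinM -EFinD lee_fin /w'.
    apply: (@le_trans _ _ (2 * U s k ^+ 2 + 2 * (t * (a k * rho' s k)) ^+ 2)).
      by have := sqr_ge0 (U s k + t * (a k * rho' s k)); move: (t * _) => y; nra.
    rewrite lerD2l -(mulrA 2) ler_wpM2l// (mulrA t) exprMn -(mulrA ((t * M) ^+ 2)).
    apply: ler_pM; rewrite ?sqr_ge0//.
      have h1 := mulr_ge0 (ltW t0) (ltW (a0 k)).
      by rewrite ler_pXn2r ?nnegrE// ler_wpM2l// ltW.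
    by rewrite expr2 ler_wpM2r ?r0'// rB'.
  rewrite esumD; last 2 first.
  - by move=> k _; rewrite -EFinM lee_fin mulr_ge0// sqr_ge0.
  - by move=> k _; rewrite -EFinM lee_fin mulr_ge0// r0'.
  rewrite !esumZl//; last 2 first.
  - by move=> k; rewrite lee_fin r0'.
  - by move=> k; rewrite lee_fin sqr_ge0.
  by rewrite (P2c_mass delta0 (hPI' s Is)) -EFinM lte_add_pinfty ?ltry// lte_mul_pinfty.
- move=> k; split; first exact: w'L2.
  exists (fun s => dlap delta (w' s) k); split; last by apply: aeW.
  split; first exact: L2_dlap.
  by have [] := hac' k.
Qed.

End Contraction.

(** * Growth of the squared distance along the semigroup *)

Section Dissipation.
Variables (R : realType) (delta : R) (V : int -> R) (M Lam : R).
Variable S : R -> (int -> R) -> (int -> R).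
Hypothesis delta0 : 0 < delta.
Local Notation a := (dlap delta V).
Hypothesis a0 : forall k, 0 < a k.
Hypothesis aM : forall k, a k <= M.
Hypothesis Lam0 : 0 <= Lam.
Hypothesis aLam : forall k, dlap delta (fun j => a j ^+ 2) k <= Lam * a k.
Hypothesis genS : generated_semigroup delta V S.

Lemma Dsq_ge0 (rb eb : int -> R) : (0 <= Dsq delta rb eb)%E.
Proof.
apply: le_ereal_inf_tmp => _ [rho [w [_ ->]]]; rewrite /action.
rewrite mule_ge0 ?lee_fin ?(ltW delta0)//; apply: esum_ge0 => k _.
by apply: integral_ge0 => s _; exact: Qf_ge0.
Qed.

Lemma Dsq_semigroup (rb eb : int -> R) (t : R) : 0 < t ->
  P2c delta rb -> P2c delta eb -> (Dsq delta rb eb < +oo)%E ->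
  (Dsq delta (S t rb) eb <= (expR (Lam * t) * fine (Dsq delta rb eb) +
     2 * t * (ener delta V eb - ener delta V rb + M ^+ 2 * t))%:E)%E.
Proof.
move=> t0 hr he Df; have D0 := Dsq_ge0 rb eb.
have fD : Dsq delta rb eb \is a fin_num by rewrite ge0_fin_numE.
have e0 : 0 < expR (Lam * t) by exact: expR_gt0.
apply: (@le_trans _ _ (expR (Lam * t) * fine (Dsq delta rb eb) +
    2 * t * (ener delta V eb - ener delta V (S t rb)))%:E); last first.
  rewrite lee_fin lerD2l ler_wpM2l ?mulr_ge0 ?(ltW t0)//.
  have := ener_semigroup delta0 a0 aM genS hr t0; lra.
apply/lee_addgt0Pr => e ep.
(* The infimum need not be attained; a slack of e / e^(Lambda t) becomes e after the contraction
   factor. *)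
have [_ [rho [w [adm ->]]] Ae] := lb_ereal_inf_adherent (divr_gt0 ep e0) fD.
have Ap : (action delta rho w < +oo)%E.
  by apply: lt_trans Ae _; rewrite -/(Dsq delta rb eb) -(fineK fD) -EFinD ltry.
apply: le_trans (transport_curve delta0 a0 aM Lam0 aLam genS t0 hr he adm Ap) _.
move: Ae; rewrite -/(Dsq delta rb eb) -(fineK fD) -EFinD => /ltW Ae.
rewrite -EFinD addrAC EFinD leeD2r//.
apply: le_trans; first by apply: lee_wpmul2l Ae; rewrite lee_fin ltW.
by rewrite -EFinM lee_fin mulrDr mulrCA divff ?gt_eqF// mulr1.
Qed.

End Dissipation.

(** From e^(-x) >= 1 - x follows e^x <= 1 / (1 - x), which the polynomial dominates on [0, 1/2]. It
    gives an explicit remainder in the difference quotient. *)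
Lemma expR_le_quadratic (R : realType) (x : R) : 0 <= x -> x <= 2^-1 ->
  expR x <= 1 + x + 2 * x ^+ 2.
Proof.
move=> x0 x2; have h := expR_ge1Dx (- x).
have p := expR_gt0 x; have : expR x * expR (- x) = 1 by rewrite -expRD subrr expR0.
move: (expR x) (expR (- x)) p h => u v u0 h uv.
have h1 : u * (1 - x) <= 1 by have := ler_wpM2l (ltW u0) h; rewrite uv.
have h2 : 1 <= (1 + x + 2 * x ^+ 2) * (1 - x) by nra.
have x1 : 0 < 1 - x by lra.
by rewrite -(ler_pM2r x1); lra.
Qed.

Theorem theorem1p3 (R : realType) (delta : R) (V : int -> R)
  (S : R -> (int -> R) -> (int -> R)) :
  0 < delta ->
  (forall k, 0 < dlap delta V k) ->
  (exists M : R, forall k, dlap delta V k <= M) ->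
  has_ubound [set dlap delta (fun j => dlap delta V j ^+ 2) k / dlap delta V k
             | k in [set: int]] ->
  generated_semigroup delta V S ->
  lambda_contractive delta
    (- sup [set dlap delta (fun j => dlap delta V j ^+ 2) k / dlap delta V k
           | k in [set: int]])
    S (energy delta V).
Proof.
move=> delta0 a0 [M aM] hub genS rb eb hr he Df.
set A := [set _ | _ in _] in hub *; set Lam := sup A.
have leLam k : dlap delta (fun j => dlap delta V j ^+ 2) k / dlap delta V k <= Lam.
  by apply: ub_le_sup => //; exists k.
have aLam k : dlap delta (fun j => dlap delta V j ^+ 2) k <= Lam * dlap delta V k.
  by rewrite -ler_pdivrMr.
have Lam0 : 0 <= Lam.
  have [k hk] := @no_positive_strictly_concave R (fun j => dlap delta V j ^+ 2)
    (fun k => exprn_gt0 2 (a0 k)).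
  apply: le_trans (leLam k); rewrite divr_ge0 ?(ltW (a0 k))//.
  by rewrite {1}/dlap divr_ge0 ?sqr_ge0.
rewrite !(energyE delta0 a0 aM)//.
have D0 := Dsq_ge0 delta0 rb eb.
have fD : Dsq delta rb eb \is a fin_num by rewrite ge0_fin_numE.
pose d := fine (Dsq delta rb eb); pose E := ener delta V eb - ener delta V rb.
have d0 : 0 <= d by exact: fine_ge0.
(* Coefficient of t in the bound on the quotient: Lambda^2 d from the quadratic term of the
   exponential, M^2 from the energy along the flow. *)
pose K := Lam ^+ 2 * d + M ^+ 2.
have K0 : 0 <= K by rewrite addr_ge0 ?sqr_ge0// mulr_ge0 ?sqr_ge0.
pose f (t : R) := ((Dsq delta (S t rb) eb - Dsq delta rb eb) * ((2 * t)^-1)%R%:E)%E.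
have bnd (t : R) : 0 < t -> Lam * t <= 2^-1 -> (f t <= (Lam / 2 * d + E + K * t)%:E)%E.
  rewrite /f => t0 tL; have t2 : 0 < 2 * t by rewrite mulr_gt0.
  have D't := Dsq_semigroup delta0 a0 aM Lam0 aLam genS t0 hr he Df; have D'0 := Dsq_ge0 delta0 (S t rb) eb.
  have fD' : Dsq delta (S t rb) eb \is a fin_num.
    by rewrite ge0_fin_numE//; apply: le_lt_trans D't _; rewrite ltry.
  move: D't; rewrite -(fineK fD') -(fineK fD) -/d -/E -EFinB -EFinM !lee_fin /= => D't.
  rewrite ler_pdivrMr//.
  have := expR_le_quadratic (mulr_ge0 Lam0 (ltW t0)) tL => he'.
  have := ler_wpM2r d0 he'; rewrite /K; lra.
have lims : (limf_esup f (0:R)^'+ <= (Lam / 2 * d + E)%:E)%E.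
  apply/lee_addgt0Pr => e e0.
  (* The first entry ensures K t <= e, the second Lambda t <= 1/2; the added 1 keeps the
     denominators positive. *)
  pose eta := Num.min (e / (K + 1)) ((Lam + 1)^-1 / 2).
  have K1 : 0 < K + 1 by rewrite ltr_wpDl.
  have L1 : 0 < Lam + 1 by rewrite ltr_wpDl.
  have eta0 : 0 < eta by rewrite lt_min !divr_gt0// invr_gt0.
  apply: (@le_trans _ _ (ereal_sup [set f t | t in [set t : R | 0 < t < eta]])).
    apply: ereal_inf_lbound; exists [set t : R | 0 < t < eta] => //.
    near=> t; rewrite /=; apply/andP; split; near: t.
      exact: nbhs_right_gt.
    exact: nbhs_right_lt.
  apply: ge_ereal_sup => _ [t /= /andP[t0 teta] <-].
  move: teta; rewrite lt_min => /andP[te tL].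
  apply: le_trans (bnd t t0 _) _.
    move: tL; rewrite ltr_pdivlMr// => /ltW tL.
    have := ler_wpM2l (ltW L1) tL; rewrite divff ?gt_eqF//; lra.
  rewrite -EFinD lee_fin lerD2l.
  by move: te; rewrite ltr_pdivlMr// => /ltW te; lra.
(* With lambda = -Lambda the distance term cancels Lambda d / 2, leaving the energy difference. *)
rewrite -{2}(fineK fD) -/d -EFinM -EFinB.
apply: le_trans; first exact: leeD2r lims.
by rewrite -EFinD lee_fin -/E; lra.
Unshelve. all: by end_near.
Qed.
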